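(* Let $\mathbb K\in\{\mathbb R,\mathbb C\}$ and let $P$ be the canonical Lie–Poisson bivector on $\mathfrak{sl}(3,\mathbb K)^*$. Let $X_0,\dots,X_9$ be the generators of the weight spaces of the 10-dimensional irreducible representation $W^*$ of quadratic vector fields on $\mathfrak{sl}(3,\mathbb K)^*$, and let $U$ be the 27-dimensional irreducible module of quadratic polynomials on $\mathfrak{sl}(3,\mathbb K)^*$, both described explicitly in the context. Then for any $b=(b_0,\dots,b_9)\in\mathbb K^{10}$ there exists a quadratic polynomial $Q_b\in U$ such that $$[[X_b,P],[X_b,P]]=2\,P(Q_b)\wedge P,\qquad\text{where } X_b:=b_0X_0+\cdots+b_9X_9.$$ The polynomial $Q_b$ is given by the explicit formula $$\begin{aligned}Q_b=6\big(&(-4b_2b_4-12b_5b_7)x_{21}x_{13}+(12b_0b_7-8b_2b_3)x_{23}x_{13}+(-b_0^2+4b_1b_4-4b_2b_5+4b_3b_6)x_{13}x_{31}\\ &+(-4b_2b_6-12b_3b_8)x_{13}x_{32}+(-4b_0b_2-4b_1b_3+12b_6b_7)y_{13}x_{13}+(12b_5b_8+4b_6^2)x_{32}^2\\ &+(4b_0b_6+8b_1b_5)y_{23}x_{32}+(b_0^2-4b_3b_6)y_{13}^2+(-b_0^2-4b_1b_4+4b_2b_5+4b_3b_6)y_{23}y_{13}\\ &+(b_0^2-4b_2b_5)y_{23}^2+(-12b_1b_9-4b_4b_6)y_{23}x_{31}+(4b_5^2+12b_6b_9)x_{31}^2+(4b_3^2+12b_4b_7)x_{23}^2\\ &+(-4b_0b_3-4b_2b_4+12b_5b_7)y_{23}x_{23}+(-4b_0b_4+12b_2b_9-4b_3b_5)y_{23}x_{21}+(12b_3b_9+4b_4^2)x_{21}^2\\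 &+(-4b_1b_3-12b_6b_7)y_{23}x_{13}+(12b_1b_7+4b_2^2)x_{13}^2+(4b_0b_1+8b_2b_6)y_{23}x_{12}+(4b_1^2+12b_2b_8)x_{12}^2\\ &+(-4b_1b_5-12b_4b_8)x_{32}y_{13}+(4b_5b_6-36b_8b_9)x_{32}x_{31}+(4b_0b_5+8b_4b_6)y_{13}x_{31}\\ &+(-12b_2b_9-4b_3b_5)x_{23}x_{31}+(-b_0^2+4b_1b_4+4b_2b_5-4b_3b_6)x_{23}x_{32}+(-4b_2b_4-12b_5b_7)x_{23}y_{13}\\ &+(-4b_1b_3-12b_6b_7)x_{12}x_{23}+(-4b_1b_5-12b_4b_8)x_{31}x_{12}+(12b_0b_8-8b_1b_6)x_{32}x_{12}\\ &+(-4b_0b_1-4b_2b_6+12b_3b_8)x_{12}y_{13}+(4b_1b_2-36b_7b_8)x_{12}x_{13}\\ &+(-b_0^2-4b_1b_4+4b_2b_5+4b_3b_6)x_{12}x_{21}+(4b_3b_4-36b_7b_9)x_{21}x_{23}+(12b_0b_9-8b_4b_5)x_{31}x_{21}\\ &+(-12b_1b_9-4b_4b_6)x_{32}x_{21}+(4b_0b_4+8b_3b_5)x_{21}y_{13}\big).\end{aligned}$$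
   Context: $[\cdot,\cdot]$ is the Schouten bracket, normalized by $[X,f]=Xf$, $[X,Y]$ the Lie bracket for vector fields, $[R,Q]=-(-1)^{(r-1)(q-1)}[Q,R]$, $[R,Q\wedge S]=[R,Q]\wedge S+(-1)^{(r-1)q}Q\wedge[R,S]$ for $R,Q$ of degrees $r,q$. For a bivector $\eta$ and a function $f$, $\eta(f):=[\eta,f]$ (contraction of $\eta$ with $df$ over the second index). Coordinates on $\mathfrak{sl}(3,\mathbb K)^*$: $x_{ij}$ ($i\ne j$), $y_{13}=x_{11}-x_{33}$, $y_{23}=x_{22}-x_{33}$, the linear functions given by the matrices $E_{ij}$, $E_{11}-E_{33}$, $E_{22}-E_{33}$ in $\mathfrak{sl}(3,\mathbb K)$; the bracket of $P$ is $\{x_{ij},x_{kl}\}=\delta_{jk}x_{il}-\delta_{il}x_{kj}$. $\mathfrak{sl}(3,\mathbb K)$ acts on vector fields and functions on $\mathfrak{sl}(3,\mathbb K)^*$ by Lie derivatives along the linear hamiltonian vector fields $P(x)$, $x\in\mathfrak{sl}(3,\mathbb K)$. $W^*$ is the 10-dimensional irreducible submodule (isomorphic to $S^3(V^* )$, $V$ the natural 3-dimensional representation) of the space of quadratic vector fields spanned by the following $X_0,\dots,X_9$, each of which generates a (one-dimensional) weight space: $$\begin{aligned} X_0={}&((4y_{13}-2y_{23})x_{12}-6x_{13}x_{32})\tfrac{\partial}{\partial x_{12}}+((-4y_{13}+2y_{23})x_{13}+6x_{12}x_{23})\tfrac{\partial}{\partial x_{13}}+((2y_{13}-4y_{23})x_{21}+6x_{23}x_{31})\tfrac{\partial}{\partial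 x_{21}}\\&+((-2y_{13}+4y_{23})x_{23}-6x_{13}x_{21})\tfrac{\partial}{\partial x_{23}}+((-2y_{13}-2y_{23})x_{31}-6x_{32}x_{21})\tfrac{\partial}{\partial x_{31}}+((2y_{13}+2y_{23})x_{32}+6x_{12}x_{31})\tfrac{\partial}{\partial x_{32}}\\&+(-2y_{13}^2-4y_{13}y_{23}+4y_{23}^2)\tfrac{\partial}{\partial y_{13}}+(-4y_{13}^2+4y_{13}y_{23}+2y_{23}^2)\tfrac{\partial}{\partial y_{23}},\\ X_1={}&-3x_{12}^2\tfrac{\partial}{\partial x_{12}}+6x_{13}x_{12}\tfrac{\partial}{\partial x_{13}}+(-3x_{12}x_{21}+3x_{13}x_{31}-3x_{23}x_{32}+y_{13}y_{23}+y_{23}^2)\tfrac{\partial}{\partial x_{21}}+(-2x_{13}y_{13}+4x_{13}y_{23})\tfrac{\partial}{\partial x_{23}}\\&+(3x_{12}x_{31}-x_{32}y_{13}+5x_{32}y_{23})\tfrac{\partial}{\partial x_{31}}-3x_{32}x_{12}\tfrac{\partial}{\partial x_{32}}+(2x_{12}y_{13}+5x_{12}y_{23}-3x_{13}x_{32})\tfrac{\partial}{\partial y_{13}}+(4x_{12}y_{13}+x_{12}y_{23}+3x_{13}x_{32})\tfrac{\partial}{\partial y_{23}},\\ X_2={}&-6x_{13}x_{12}\tfrac{\partial}{\partial x_{12}}+3x_{13}^2\tfrac{\partial}{\partial x_{13}}+(-3x_{13}x_{21}+x_{23}y_{13}+4x_{23}y_{23})\tfrac{\partial}{\partial x_{21}}+3x_{13}x_{23}\tfrac{\partial}{\partial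 x_{23}}\\&+(-3x_{12}x_{21}+3x_{13}x_{31}+3x_{23}x_{32}+y_{13}y_{23}-2y_{23}^2)\tfrac{\partial}{\partial x_{31}}+(2x_{12}y_{13}+2x_{12}y_{23})\tfrac{\partial}{\partial x_{32}}\\&+(6x_{12}x_{23}+2x_{13}y_{13}+2x_{13}y_{23})\tfrac{\partial}{\partial y_{13}}+(3x_{12}x_{23}+4x_{13}y_{13}-5x_{13}y_{23})\tfrac{\partial}{\partial y_{23}},\\ X_3={}&(3x_{12}x_{21}+3x_{13}x_{31}-3x_{23}x_{32}-y_{13}^2-y_{13}y_{23})\tfrac{\partial}{\partial x_{12}}+(-4x_{23}y_{13}+2x_{23}y_{23})\tfrac{\partial}{\partial x_{13}}+3x_{21}^2\tfrac{\partial}{\partial x_{21}}-6x_{23}x_{21}\tfrac{\partial}{\partial x_{23}}\\&+3x_{31}x_{21}\tfrac{\partial}{\partial x_{31}}+(-3x_{21}x_{32}-5x_{31}y_{13}+x_{31}y_{23})\tfrac{\partial}{\partial x_{32}}+(-x_{21}y_{13}-4x_{21}y_{23}-3x_{23}x_{31})\tfrac{\partial}{\partial y_{13}}\\&+(-5x_{21}y_{13}-2x_{21}y_{23}+3x_{23}x_{31})\tfrac{\partial}{\partial y_{23}},\\ X_4={}&(3x_{12}x_{23}-4x_{13}y_{13}-x_{13}y_{23})\tfrac{\partial}{\partial x_{12}}-3x_{13}x_{23}\tfrac{\partial}{\partial x_{13}}+6x_{23}x_{21}\tfrac{\partial}{\partial x_{21}}-3x_{23}^2\tfrac{\partial}{\partial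 x_{23}}+(-2x_{21}y_{13}-2x_{21}y_{23})\tfrac{\partial}{\partial x_{31}}\\&+(3x_{12}x_{21}-3x_{13}x_{31}-3x_{23}x_{32}+2y_{13}^2-y_{13}y_{23})\tfrac{\partial}{\partial x_{32}}+(-3x_{13}x_{21}+5x_{23}y_{13}-4x_{23}y_{23})\tfrac{\partial}{\partial y_{13}}\\&+(-6x_{13}x_{21}-2x_{23}y_{13}-2x_{23}y_{23})\tfrac{\partial}{\partial y_{23}},\\ X_5={}&(4x_{32}y_{13}-2x_{32}y_{23})\tfrac{\partial}{\partial x_{12}}+(-3x_{12}x_{21}-3x_{13}x_{31}+3x_{23}x_{32}+y_{13}^2-3y_{13}y_{23}+2y_{23}^2)\tfrac{\partial}{\partial x_{13}}-3x_{31}x_{21}\tfrac{\partial}{\partial x_{21}}\\&+(5x_{21}y_{13}-4x_{21}y_{23}+3x_{23}x_{31})\tfrac{\partial}{\partial x_{23}}-3x_{31}^2\tfrac{\partial}{\partial x_{31}}+6x_{31}x_{32}\tfrac{\partial}{\partial x_{32}}+(6x_{21}x_{32}-4x_{31}y_{13}+2x_{31}y_{23})\tfrac{\partial}{\partial y_{13}}\\&+(3x_{21}x_{32}-5x_{31}y_{13}+7x_{31}y_{23})\tfrac{\partial}{\partial y_{23}},\\ X_6={}&3x_{32}x_{12}\tfrac{\partial}{\partial x_{12}}+(4x_{12}y_{13}-5x_{12}y_{23}-3x_{13}x_{32})\tfrac{\partial}{\partial x_{13}}+(2x_{31}y_{13}-4x_{31}y_{23})\tfrac{\partial}{\partial x_{21}}\\&+(3x_{12}x_{21}-3x_{13}x_{31}+3x_{23}x_{32}-2y_{13}^2+3y_{13}y_{23}-y_{23}^2)\tfrac{\partial}{\partial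 x_{23}}-6x_{31}x_{32}\tfrac{\partial}{\partial x_{31}}+3x_{32}^2\tfrac{\partial}{\partial x_{32}}\\&+(-3x_{12}x_{31}-7x_{32}y_{13}+5x_{32}y_{23})\tfrac{\partial}{\partial y_{13}}+(-6x_{12}x_{31}-2x_{32}y_{13}+4x_{32}y_{23})\tfrac{\partial}{\partial y_{23}},\\ X_7={}&-9x_{12}^2\tfrac{\partial}{\partial x_{13}}+(-9x_{12}x_{31}+3x_{32}y_{13}+3x_{32}y_{23})\tfrac{\partial}{\partial x_{21}}+(6x_{12}y_{13}-3x_{12}y_{23}+9x_{13}x_{32})\tfrac{\partial}{\partial x_{23}}\\&+9x_{32}^2\tfrac{\partial}{\partial x_{31}}+18x_{32}x_{12}\tfrac{\partial}{\partial y_{13}}+9x_{32}x_{12}\tfrac{\partial}{\partial y_{23}},\\ X_8={}&9x_{13}^2\tfrac{\partial}{\partial x_{12}}-9x_{23}^2\tfrac{\partial}{\partial x_{21}}+(9x_{13}x_{21}-3x_{23}y_{13}+6x_{23}y_{23})\tfrac{\partial}{\partial x_{31}}+(-9x_{12}x_{23}-6x_{13}y_{13}+3x_{13}y_{23})\tfrac{\partial}{\partial x_{32}}\\&-9x_{13}x_{23}\tfrac{\partial}{\partial y_{13}}+9x_{13}x_{23}\tfrac{\partial}{\partial y_{23}},\\ X_9={}&(9x_{21}x_{32}-3x_{31}y_{13}-3x_{31}y_{23})\tfrac{\partial}{\partial x_{12}}+(3x_{21}y_{13}-6x_{21}y_{23}-9x_{23}x_{31})\tfrac{\partial}{\partial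 x_{13}}+9x_{21}^2\tfrac{\partial}{\partial x_{23}}-9x_{31}^2\tfrac{\partial}{\partial x_{32}}\\&-9x_{31}x_{21}\tfrac{\partial}{\partial y_{13}}-18x_{31}x_{21}\tfrac{\partial}{\partial y_{23}}. \end{aligned}$$ $U$ is the 27-dimensional irreducible submodule (with highest weight $2\omega_1+2\omega_2$, $\omega_1,\omega_2$ the fundamental weights) of the space of homogeneous quadratic polynomials on $\mathfrak{sl}(3,\mathbb K)^*$, i.e. the submodule generated by $x_{13}^2$.
   Formalization: The printed formula for Q_b fails for the listed X_i (e.g. b_3=1, other b_i=0: the weights of the two sides differ); here Q_b = -9 q(2b_0,b_1,b_2,b_4,b_3,b_5,b_6,b_8,b_7,b_9), where 6 q(b_0,...,b_9) is the printed Q_b. *)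

(* Defs.v *)
From HB Require Import structures.
From mathcomp Require Import all_boot all_order all_algebra.
From mathcomp Require Import reals complex mpoly ring.

Set Implicit Arguments.
Unset Strict Implicit.
Unset Printing Implicit Defensive.

Import Order.TTheory GRing.Theory Num.Theory.
Local Open Scope ring_scope.

Variant base_field := RealNumbers | ComplexNumbers.

Definition scalars (R : realType) (k : base_field) : numFieldType :=
  match k with RealNumbers => R | ComplexNumbers => R[i] end.

(* A multivector field R on K^n with polynomial coefficients: R A is the       *)
(* coefficient of d_{a_1} /\ ... /\ d_{a_r}, where A = {a_1 < ... < a_r}.      *)
Definition mvf (K : fieldType) (n : nat) : Type := {ffun {set 'I_n} -> {mpoly K[n]}}.

HB.instance Definition _ (K : fieldType) (n : nat) :=
  GRing.Lmodule.copy (mvf K n) {ffun {set 'I_n} -> {mpoly K[n]}}.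

Section Multivectors.
Variables (K : fieldType) (n : nat).
Implicit Types (R Q S : mvf K n) (A B C : {set 'I_n}) (f : {mpoly K[n]}).

Definition of_deg (r : nat) R : Prop := forall A, R A != 0 -> #|A| = r.

Definition mvfun f : mvf K n := [ffun A => if A == set0 then f else 0].

Definition vterm f (i : 'I_n) : mvf K n := [ffun A => if A == [set i] then f else 0].

Definition inv A B : nat := \sum_(a in A) \sum_(b in B) (b < a)%N.

Definition wedge R Q : mvf K n :=
  [ffun C : {set 'I_n} => \sum_(A : {set 'I_n} | A \subset C)
     (-1) ^+ inv A (C :\: A) * (R A * Q (C :\: A))].

Definition dx (i : 'I_n) R : mvf K n := [ffun A => (R A)^`M(i)].

(* Left and right derivatives with respect to the odd variable d_i:            *)
(* d_i /\ d_A |-> d_A and d_A /\ d_i |-> d_A, for i not in A.                  *)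
Definition lder (i : 'I_n) R : mvf K n :=
  [ffun A : {set 'I_n} => if i \in A then 0 else (-1) ^+ inv [set i] A * R (i |: A)].

Definition rder (i : 'I_n) R : mvf K n :=
  [ffun A : {set 'I_n} => if i \in A then 0 else (-1) ^+ inv A [set i] * R (i |: A)].

(* The normalization is the one determined by schoutenDl, schoutenDr,          *)
(* schouten_vf_fun, schouten_vf_vf, schouten_antisym and schouten_leibniz.     *)
Definition schouten R Q : mvf K n :=
  \sum_(i < n) (wedge (rder i R) (dx i Q) - wedge (dx i R) (lder i Q)).

(* Structure constants of the exterior algebra: d_A /\ d_B = sum_C sg A B C d_C. *)
Definition sg A B C : {mpoly K[n]} :=
  if [disjoint A & B] && (A :|: B == C) then (-1) ^+ inv A B else 0.

Lemma wedgeE R Q C : wedge R Q C = \sum_A \sum_B sg A B C * (R A * Q B).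
Proof.
rewrite ffunE big_mkcond; apply: eq_bigr => A _.
case: ifPn => [sAC|nsAC].
  rewrite (bigD1 (C :\: A)) //= big1 => [|B neB].
    have eC : A :|: C :\: A = C by rewrite -{1}(setIidPr sAC) setID.
    rewrite addr0 /sg eC eqxx andbT.
    by rewrite -setI_eq0 setIDA setDIl setDv set0I eqxx.
  rewrite /sg; case: andP; last by rewrite mul0r.
  case=> dAB /eqP eC; case/eqP: neB; rewrite -eC setDUl setDv set0U.
  by apply/esym/setDidPl; rewrite disjoint_sym.
rewrite big1 // => B _; rewrite /sg; case: andP; last by rewrite mul0r.
by case=> _ /eqP eC; rewrite -eC subsetUl in nsAC.
Qed.

Lemma lderE i R A : lder i R A = \sum_B sg [set i] A B * R B.
Proof.
rewrite ffunE; case: ifPn => iA.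
  by rewrite big1 // => B _; rewrite /sg disjoints1 iA mul0r.
rewrite (bigD1 (i |: A)) //= /sg disjoints1 iA eqxx big1 ?addr0 // => B.
by rewrite eq_sym => /negPf ->; rewrite mul0r.
Qed.

Lemma inv_swap A B : [disjoint A & B] -> (inv A B + inv B A)%N = (#|A| * #|B|)%N.
Proof.
move=> dAB; rewrite /inv [X in (_ + X)%N]exchange_big -big_split /=.
rewrite -sum1_card big_distrl /=; apply: eq_bigr => a aA.
rewrite mul1n -sum1_card -big_split; apply: eq_bigr => b bB.
have : a != b by apply: contraTneq bB => <-; rewrite (disjointFr dAB).
by rewrite -val_eqE /=; case: ltngtP.
Qed.

Lemma sg_swap A B C : sg A B C = (-1) ^+ (#|A| * #|B|) * sg B A C.
Proof.
rewrite /sg disjoint_sym setUC; case: andP => [[dAB _]|]; last by rewrite mulr0.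
by rewrite -inv_swap 1?disjoint_sym // exprD -mulrA -expr2 sqrr_sign mulr1.
Qed.

Lemma invUl A B C : [disjoint A & B] -> inv (A :|: B) C = (inv A C + inv B C)%N.
Proof. by move=> dAB; rewrite /inv -bigU //=; apply: eq_bigl => x; rewrite !inE. Qed.

Lemma invUr A B C : [disjoint B & C] -> inv A (B :|: C) = (inv A B + inv A C)%N.
Proof.
move=> dBC; rewrite /inv -big_split; apply: eq_bigr => a _.
by rewrite -bigU //=; apply: eq_bigl => x; rewrite !inE.
Qed.

Lemma sgA A B C D : \sum_M sg A B M * sg M C D = \sum_M sg B C M * sg A M D.
Proof.
have E1 : \sum_M sg A B M * sg M C D = sg A B (A :|: B) * sg (A :|: B) C D.
  rewrite (bigD1 (A :|: B)) //= big1 ?addr0 // => M; rewrite /sg eq_sym.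
  by move=> /negPf ->; rewrite andbF mul0r.
have E2 : \sum_M sg B C M * sg A M D = sg B C (B :|: C) * sg A (B :|: C) D.
  rewrite (bigD1 (B :|: C)) //= big1 ?addr0 // => M; rewrite /sg eq_sym.
  by move=> /negPf ->; rewrite andbF mul0r.
rewrite {}E1 {}E2 /sg !eqxx !andbT -setUA.
rewrite -!setI_eq0 setIUr setIUl !setU_eq0 !setI_eq0.
case dAB: [disjoint A & B]; case dBC: [disjoint B & C];
  case dAC: [disjoint A & C] => /=; rewrite ?mul0r ?mulr0 //.
case: eqP; rewrite ?mulr0 // => _.
by rewrite invUl // invUr // -!exprD; congr (_ ^+ _); rewrite addnC -!addnA addnC -addnA.
Qed.

Lemma wedgeA R Q S : wedge (wedge R Q) S = wedge R (wedge Q S).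
Proof.
apply/ffunP => D; rewrite !wedgeE.
transitivity (\sum_A \sum_B \sum_C (\sum_M sg A B M * sg M C D) * (R A * Q B * S C)).
  transitivity (\sum_M \sum_C \sum_A \sum_B sg A B M * sg M C D * (R A * Q B * S C)).
    apply: eq_bigr => M _; apply: eq_bigr => C _; rewrite wedgeE.
    rewrite mulr_suml mulr_sumr; apply: eq_bigr => A _.
    rewrite mulr_suml mulr_sumr; apply: eq_bigr => B _; ring.
  rewrite exchange_big /=; under [RHS]eq_bigr do rewrite exchange_big.
  rewrite [RHS]exchange_big; apply: eq_bigr => C _.
  rewrite [LHS]exchange_big; apply: eq_bigr => A _.
  rewrite [LHS]exchange_big; apply: eq_bigr => B _.
  by rewrite mulr_suml.
apply: eq_bigr => A _.
transitivity (\sum_M \sum_B \sum_C sg B C M * sg A M D * (R A * Q B * S C)).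
  rewrite [RHS]exchange_big; apply: eq_bigr => B _.
  rewrite [RHS]exchange_big; apply: eq_bigr => C _.
  by rewrite sgA mulr_suml.
apply: eq_bigr => M _; rewrite wedgeE !mulr_sumr; apply: eq_bigr => B _.
by rewrite !mulr_sumr; apply: eq_bigr => C _; ring.
Qed.

Lemma sum_sgl A B (F : {set 'I_n} -> {mpoly K[n]}) :
  \sum_M sg A B M * F M =
  if [disjoint A & B] then (-1) ^+ inv A B * F (A :|: B) else 0.
Proof.
rewrite (bigD1 (A :|: B)) //= {1}/sg eqxx andbT big1 => [|M].
  by rewrite addr0; case: ifP; rewrite ?mul0r.
by rewrite /sg eq_sym => /negPf ->; rewrite andbF mul0r.
Qed.

Lemma sum_sgr i B (F : {set 'I_n} -> {mpoly K[n]}) :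
  \sum_M sg [set i] M B * F M =
  if i \in B then (-1) ^+ inv [set i] (B :\ i) * F (B :\ i) else 0.
Proof.
case: ifPn => iB; last first.
  apply: big1 => M _; rewrite /sg; case: andP; last by rewrite mul0r.
  by case=> _ /eqP eB; rewrite -eB !inE eqxx in iB.
rewrite (bigD1 (B :\ i)) //= {1}/sg disjoints1 !inE eqxx setD1K // eqxx /=.
rewrite big1 ?addr0 // => M neM; rewrite /sg disjoints1.
case: andP; last by rewrite mul0r.
case=> iM /eqP eB; case/eqP: neM; rewrite -eB setDUl setDv set0U.
by apply/esym/setDidPl; rewrite disjoint_sym disjoints1.
Qed.

Lemma disjUl A B C : [disjoint A :|: B & C] = [disjoint A & C] && [disjoint B & C].
Proof. by rewrite -!setI_eq0 setIUl setU_eq0. Qed.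

Lemma disjUr A B C : [disjoint A & B :|: C] = [disjoint A & B] && [disjoint A & C].
Proof. by rewrite -!setI_eq0 setIUr setU_eq0. Qed.

Lemma inv1_swap i (D : {set 'I_n}) : i \notin D -> (inv [set i] D + inv D [set i])%N = #|D|.
Proof. by move=> iD; rewrite inv_swap ?disjoints1 // cards1 mul1n. Qed.

Lemma lder_sg i A (D E : {set 'I_n}) :
  \sum_M sg [set i] A M * sg D E M =
  \sum_F sg [set i] F D * sg F E A +
  (-1) ^+ #|D| * \sum_F sg [set i] F E * sg D F A.
Proof.
rewrite sum_sgl !sum_sgr disjoints1.
have [iD|iD] := boolP (i \in D); have [iE|iE] := boolP (i \in E).
- have dDE : [disjoint D & E] = false.
    by apply/negP => /disjointFr /(_ iD); rewrite iE.
  rewrite {1}/sg dDE mulr0 if_same.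
  move: (setD1K iD) (setD1K iE) (setD11 i D) (setD11 i E).
  move: (D :\ i) (E :\ i) => D' E' <- <- /negbT iD' /negbT iE'.
  rewrite /sg disjUl disjUr [[disjoint D' & [set i]]]disjoint_sym !disjoints1 iD' iE'.
  rewrite setUCA setUA /=; case: ifP => [/andP[dDE' _]|]; last by rewrite !mulr0 addr0.
  rewrite cardsU1 iD' -(inv1_swap iD') invUr ?invUl ?disjoints1 //.
  rewrite !exprD expr1; set s := (-1) ^+ inv [set i] E'.
  have ss : s * s = 1 by rewrite -expr2 sqrr_sign.
  transitivity ((1 - s * s) *
     ((-1) ^+ inv [set i] D' * (-1) ^+ inv D' [set i] * (-1) ^+ inv D' E' : {mpoly K[n]})).
    by rewrite ss subrr mul0r.
  by ring.
- rewrite mulr0 addr0.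
  move: (setD1K iD) (setD11 i D); move: (D :\ i) => D' <- /negbT iD'.
  rewrite /sg disjUl !disjoints1 iE /= -setUA.
  have [dDE|_] := boolP [disjoint D' & E]; last by rewrite !mulr0 if_same.
  have iDE : i \notin D' :|: E by rewrite inE negb_or iD'.
  have [<-|neA] := eqVneq (D' :|: E) A; last first.
    rewrite mulr0; case: ifP => // iA; case: eqP; rewrite ?mulr0 // => /setP eA.
    case/eqP: neA; apply/setP => x; have := eA x; rewrite in_setU1 [RHS]in_setU1.
    have [->|_] //= := eqVneq x i; by rewrite (negPf iDE) (negPf iA).
  rewrite iDE eqxx invUr // invUl ?disjoints1 // !exprD /=.
  set s := (-1) ^+ inv [set i] E.
  have ss : s * s = 1 by rewrite -expr2 sqrr_sign.
  rewrite [LHS](_ : _ = (s * s) *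
     ((-1) ^+ inv [set i] D' * (-1) ^+ inv D' E)); last by ring.
  by rewrite ss mul1r.
- rewrite add0r.
  move: (setD1K iE) (setD11 i E); move: (E :\ i) => E' <- /negbT iE'.
  rewrite /sg disjUr [[disjoint D & [set i]]]disjoint_sym !disjoints1 iD /= setUCA.
  have [dDE|_] := boolP [disjoint D & E']; last by rewrite !mulr0 if_same.
  have iDE : i \notin D :|: E' by rewrite inE negb_or iD.
  have [<-|neA] := eqVneq (D :|: E') A; last first.
    rewrite !mulr0; case: ifP => // iA; case: eqP; rewrite ?mulr0 // => /setP eA.
    case/eqP: neA; apply/setP => x; have := eA x; rewrite in_setU1 [RHS]in_setU1.
    have [->|_] //= := eqVneq x i; by rewrite (negPf iDE) (negPf iA).
  rewrite iDE eqxx invUr // invUr ?disjoints1 // -(inv1_swap iD) !exprD /=.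
  by ring.
- rewrite mulr0 addr0; case: ifP => // iA; rewrite /sg.
  case: andP; last by rewrite mulr0.
  case=> _ /eqP /setP /(_ i); rewrite !inE eqxx (negPf iD) (negPf iE) //.
Qed.

Lemma of_degP r R : of_deg r R <-> forall A, #|A| != r -> R A = 0.
Proof.
split=> H A; first by move=> neA; apply/eqP/contraT => /H eA; rewrite eA eqxx in neA.
by apply: contraNeq => /H ->.
Qed.

Lemma wedgeDl R1 R2 Q : wedge (R1 + R2) Q = wedge R1 Q + wedge R2 Q.
Proof.
apply/ffunP => C; rewrite !ffunE -big_split /=; apply: eq_bigr => A _.
by rewrite !ffunE; ring.
Qed.

Lemma wedgeDr R Q1 Q2 : wedge R (Q1 + Q2) = wedge R Q1 + wedge R Q2.
Proof.
apply/ffunP => C; rewrite !ffunE -big_split /=; apply: eq_bigr => A _.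
by rewrite !ffunE; ring.
Qed.

Lemma wedgeZl (a : K) R Q : wedge (a *: R) Q = a *: wedge R Q.
Proof.
apply/ffunP => C; rewrite !ffunE scaler_sumr /=; apply: eq_bigr => A _.
by rewrite !ffunE -scalerAl -scalerAr.
Qed.

Lemma wedgeZr (a : K) R Q : wedge R (a *: Q) = a *: wedge R Q.
Proof.
apply/ffunP => C; rewrite !ffunE scaler_sumr /=; apply: eq_bigr => A _.
by rewrite !ffunE -!scalerAr.
Qed.

Lemma signZ m f : (-1 : K) ^+ m *: f = (-1) ^+ m * f.
Proof.
by elim: m => [|m IH]; rewrite ?scale1r ?mul1r // !exprS -scalerA IH -mulrA scaleN1r mulN1r.
Qed.

Lemma wedgeC r q R Q : of_deg r R -> of_deg q Q ->
  wedge R Q = (-1) ^+ (r * q) *: wedge Q R.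
Proof.
move=> /of_degP dR /of_degP dQ; apply/ffunP => C.
rewrite wedgeE ffunE wedgeE signZ mulr_sumr exchange_big; apply: eq_bigr => B _.
rewrite mulr_sumr; apply: eq_bigr => A _; rewrite sg_swap.
have [<-|/dR ->] := eqVneq #|A| r; last by ring.
have [<-|/dQ ->] := eqVneq #|B| q; last by ring.
by ring.
Qed.

Lemma lder_wedge i q Q S : of_deg q Q ->
  lder i (wedge Q S) = wedge (lder i Q) S + (-1) ^+ q *: wedge Q (lder i S).
Proof.
move=> /of_degP dQ; apply/ffunP => A.
rewrite lderE [RHS]ffunE [X in _ + X]ffunE signZ !wedgeE.
transitivity (\sum_D \sum_E (\sum_M sg [set i] A M * sg D E M) * (Q D * S E)).
  under eq_bigr do rewrite wedgeE mulr_sumr.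
  rewrite exchange_big; apply: eq_bigr => D _.
  under eq_bigr do rewrite mulr_sumr.
  rewrite exchange_big; apply: eq_bigr => E _.
  by rewrite mulr_suml; apply: eq_bigr => M _; ring.
transitivity (\sum_D \sum_E ((\sum_F sg [set i] F D * sg F E A) * (Q D * S E)
  + (-1) ^+ q * ((\sum_F sg [set i] F E * sg D F A) * (Q D * S E)))).
  apply: eq_bigr => D _; apply: eq_bigr => E _; rewrite lder_sg mulrDl.
  by have [<-|/dQ ->] := eqVneq #|D| q; rewrite ?mulrA // !(mul0r, mulr0).
under eq_bigr do rewrite big_split /=.
rewrite big_split /=; congr (_ + _).
  under [RHS]eq_bigr do under eq_bigr do rewrite lderE mulr_suml mulr_sumr.
  under eq_bigr do under eq_bigr do rewrite mulr_suml.
  rewrite [LHS]exchange_big [RHS]exchange_big; apply: eq_bigr => E _.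
  by rewrite exchange_big; apply: eq_bigr => F _; apply: eq_bigr => D _; ring.
rewrite mulr_sumr; apply: eq_bigr => D _.
rewrite -mulr_sumr; congr (_ * _).
under [RHS]eq_bigr do rewrite lderE !mulr_sumr.
under [LHS]eq_bigr do rewrite mulr_suml.
by rewrite [LHS]exchange_big; apply: eq_bigr => F _; apply: eq_bigr => E _; ring.
Qed.

Lemma dx_wedge i Q S : dx i (wedge Q S) = wedge (dx i Q) S + wedge Q (dx i S).
Proof.
apply/ffunP => C; rewrite !ffunE linear_sum -big_split; apply: eq_bigr => A _ /=.
rewrite !ffunE -!signZ mderivZ mderivM -scalerDr; congr (_ *: (_ + _)); ring.
Qed.

Lemma rder_lder i r R : of_deg r R -> rder i R = (-1) ^+ r.+1 *: lder i R.
Proof.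
move=> /of_degP dR; apply/ffunP => A; rewrite !ffunE signZ.
case: ifPn => [_|iA]; first by rewrite mulr0.
have [eA|/dR ->] := eqVneq #|i |: A| r; last by rewrite !mulr0.
rewrite -eA cardsU1 iA /= add1n -(inv1_swap iA) mulrA -exprD.
congr (_ * _); rewrite -[LHS]signr_odd -[RHS]signr_odd !oddD /= !oddD.
by case: (odd _); case: (odd _).
Qed.

Lemma of_deg_lder i r R : of_deg r R -> of_deg r.-1 (lder i R).
Proof.
move=> dR A; rewrite ffunE; case: ifPn => [|iA]; first by rewrite eqxx.
have [E|/dR <- _] := eqVneq (R (i |: A)) 0; first by rewrite E mulr0 eqxx.
by rewrite cardsU1 iA.
Qed.

Lemma of_deg_rder i r R : of_deg r R -> of_deg r.-1 (rder i R).
Proof.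
move=> dR A; rewrite ffunE; case: ifPn => [|iA]; first by rewrite eqxx.
have [E|/dR <- _] := eqVneq (R (i |: A)) 0; first by rewrite E mulr0 eqxx.
by rewrite cardsU1 iA.
Qed.

Lemma rder0 i R : of_deg 0 R -> rder i R = 0.
Proof.
move=> /of_degP dR; apply/ffunP => A; rewrite !ffunE; case: ifPn => // iA.
by rewrite dR ?mulr0 // cardsU1 iA.
Qed.

Lemma lder0 i R : of_deg 0 R -> lder i R = 0.
Proof.
move=> /of_degP dR; apply/ffunP => A; rewrite !ffunE; case: ifPn => // iA.
by rewrite dR ?mulr0 // cardsU1 iA.
Qed.

Lemma wedge0l R : wedge 0 R = 0.
Proof. by rewrite -[X in wedge X]( scale0r 0) wedgeZl scale0r. Qed.

Lemma wedge0r R : wedge R 0 = 0.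
Proof. by rewrite -[X in wedge _ X]( scale0r 0) wedgeZr scale0r. Qed.

Lemma of_deg_dx i r R : of_deg r R -> of_deg r (dx i R).
Proof.
by move=> dR A; rewrite ffunE => H; apply: dR; apply: contraNneq H => ->; rewrite mderiv0.
Qed.

Lemma schouten_antisym r q R Q : of_deg r R -> of_deg q Q ->
  schouten R Q = - ((-1) ^+ (r.+1 * q.+1) *: schouten Q R).
Proof.
move=> dR dQ; rewrite /schouten scaler_sumr -sumrN; apply: eq_bigr => i _.
rewrite scalerBr opprB; congr (_ - _).
  case: r dR => [|r] dR; first by rewrite rder0 // lder0 // wedge0l wedge0r scaler0.
  rewrite (rder_lder i dR) wedgeZl (wedgeC (@of_deg_lder i _ _ dR) (@of_deg_dx i _ _ dQ)) scalerA.
  rewrite -exprD; congr (_ *: _); rewrite -[LHS]signr_odd -[RHS]signr_odd.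
  by congr (_ ^+ _); rewrite !(oddD, oddM) /=; case: (odd r); case: (odd q).
case: q dQ => [|q] dQ; first by rewrite rder0 // lder0 // wedge0l wedge0r scaler0.
rewrite (rder_lder i dQ) wedgeZl (wedgeC (@of_deg_dx i _ _ dR) (@of_deg_lder i _ _ dQ)) scalerA.
rewrite -exprD; congr (_ *: _); rewrite -[LHS]signr_odd -[RHS]signr_odd.
by congr (_ ^+ _); rewrite !(oddD, oddM) /=; case: (odd r); case: (odd q).
Qed.

Lemma schouten_leibniz r q R Q S : of_deg r R -> of_deg q Q ->
  schouten R (wedge Q S)
  = wedge (schouten R Q) S + (-1) ^+ (r.+1 * q) *: wedge Q (schouten R S).
Proof.
move=> dR dQ; rewrite /schouten.
have -> T1 T2 : wedge (\sum_(i < n) T1 i) T2 = \sum_(i < n) wedge (T1 i) T2.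
  by apply: (big_morph (wedge^~ T2)) => [x y|]; rewrite ?wedgeDl ?wedge0l.
have -> T1 T2 : wedge T1 (\sum_(i < n) T2 i) = \sum_(i < n) wedge T1 (T2 i).
  by apply: (big_morph (wedge T1)) => [x y|]; rewrite ?wedgeDr ?wedge0r.
rewrite scaler_sumr -big_split; apply: eq_bigr => i _ /=.
have wN T1 T2 : wedge (- T1) T2 = - wedge T1 T2.
  by rewrite -scaleN1r wedgeZl scaleN1r.
have wNr T1 T2 : wedge T1 (- T2) = - wedge T1 T2.
  by rewrite -scaleN1r wedgeZr scaleN1r.
rewrite dx_wedge (lder_wedge i S dQ) !wedgeDr !wedgeDl wN wNr wedgeZr.
rewrite scalerBr -!wedgeA.
have -> : wedge (rder i R) Q = (-1) ^+ (r.+1 * q) *: wedge Q (rder i R).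
  case: r dR => [|r] dR; first by rewrite rder0 // wedge0l wedge0r scaler0.
  rewrite (wedgeC (@of_deg_rder i _ _ dR) dQ); congr (_ *: _).
  rewrite -[LHS]signr_odd -[RHS]signr_odd.
  by congr (_ ^+ _); rewrite !(oddD, oddM) /= negbK.
rewrite (wedgeC (@of_deg_dx i _ _ dR) dQ) !wedgeZl scalerA -exprD.
rewrite mulSn opprD.
rewrite -!addrA; congr (_ + _); rewrite [RHS]addrCA; congr (_ + _).
Qed.

Lemma dxD i R Q : dx i (R + Q) = dx i R + dx i Q.
Proof. by apply/ffunP => A; rewrite !ffunE mderivD. Qed.

Lemma lderD i R Q : lder i (R + Q) = lder i R + lder i Q.
Proof. by apply/ffunP => A; rewrite !ffunE; case: ifP; rewrite ?addr0 ?mulrDr. Qed.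

Lemma rderD i R Q : rder i (R + Q) = rder i R + rder i Q.
Proof. by apply/ffunP => A; rewrite !ffunE; case: ifP; rewrite ?addr0 ?mulrDr. Qed.

Lemma schoutenDl R1 R2 Q : schouten (R1 + R2) Q = schouten R1 Q + schouten R2 Q.
Proof.
rewrite /schouten -big_split; apply: eq_bigr => i _ /=.
by rewrite rderD dxD !wedgeDl opprD addrACA.
Qed.

Lemma schoutenDr R Q1 Q2 : schouten R (Q1 + Q2) = schouten R Q1 + schouten R Q2.
Proof.
rewrite /schouten -big_split; apply: eq_bigr => i _ /=.
by rewrite lderD dxD !wedgeDr opprD addrACA.
Qed.

Definition vfield (X : 'I_n -> {mpoly K[n]}) : mvf K n := \sum_(i < n) vterm (X i) i.

Lemma of_deg_mvfun f : of_deg 0 (mvfun f).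
Proof.
move=> A; rewrite ffunE; have [->|A0] := eqVneq A set0; first by rewrite cards0.
by rewrite eqxx.
Qed.

Lemma vfieldE X i : vfield X [set i] = X i.
Proof.
rewrite sum_ffunE (bigD1 i) //= ffunE eqxx big1 ?addr0 // => j ji.
by rewrite ffunE (inj_eq set1_inj) eq_sym (negPf ji).
Qed.

Lemma of_deg_vfield X : of_deg 1 (vfield X).
Proof.
apply/of_degP => A A1; rewrite sum_ffunE big1 // => i _; rewrite ffunE.
by case: (eqVneq A [set i]) A1 => // ->; rewrite cards1.
Qed.

Lemma wedge_mvfun f R A : wedge (mvfun f) R A = f * R A.
Proof.
rewrite ffunE (bigD1 set0) ?sub0set //= big1 => [|B /andP[_ B0]].
  by rewrite ffunE eqxx setD0 /inv big_set0 mul1r addr0.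
by rewrite ffunE (negPf B0) mul0r mulr0.
Qed.

Lemma wedge_funr f X A : wedge (vfield X) (mvfun f) A = vfield X A * f.
Proof.
rewrite (wedgeC (@of_deg_vfield X) (@of_deg_mvfun f)) mul1n scale1r.
by rewrite wedge_mvfun mulrC.
Qed.

Lemma rder_vfield i X : rder i (vfield X) = mvfun (X i).
Proof.
apply/ffunP => A; rewrite !ffunE; have [->|A0] := eqVneq A set0.
  by rewrite inE /inv big_set0 mul1r setU0 vfieldE.
case: ifPn => // iA; rewrite (proj1 (of_degP _ _) (@of_deg_vfield X)) ?mulr0 //.
by rewrite cardsU1 iA add1n eqSS cards_eq0.
Qed.

Lemma lder_vfield i X : lder i (vfield X) = mvfun (X i).
Proof.
by rewrite -rder_vfield (rder_lder i (@of_deg_vfield X)) sqrrN expr1n scale1r.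
Qed.

Lemma dx_mvfun i f : dx i (mvfun f) = mvfun f^`M(i).
Proof. by apply/ffunP => A; rewrite !ffunE; case: ifP; rewrite ?mderiv0. Qed.

Lemma dx_vfield i X : dx i (vfield X) = vfield (fun j => (X j)^`M(i)).
Proof.
apply/ffunP => A; rewrite ffunE !sum_ffunE linear_sum; apply: eq_bigr => j _ /=.
by rewrite !ffunE; case: ifP; rewrite ?mderiv0.
Qed.

Lemma schouten_vf_fun X f :
  schouten (vfield X) (mvfun f) = mvfun (\sum_(i < n) X i * f^`M(i)).
Proof.
apply/ffunP => A; rewrite sum_ffunE [RHS]ffunE.
rewrite (_ : (if _ then _ else _) = \sum_(i < n) X i * mvfun (f^`M(i)) A).
  apply: eq_bigr => i _; rewrite (lder0 i (@of_deg_mvfun f)) wedge0r subr0.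
  by rewrite rder_vfield dx_mvfun wedge_mvfun.
case: ifPn => A0; first by apply: eq_bigr => i _; rewrite ffunE A0.
by rewrite big1 // => i _; rewrite ffunE (negPf A0) mulr0.
Qed.

Lemma schouten_vf_vf X Y :
  schouten (vfield X) (vfield Y) =
  vfield (fun j => \sum_(i < n) (X i * (Y j)^`M(i) - Y i * (X j)^`M(i))).
Proof.
apply/ffunP => A; rewrite sum_ffunE [RHS]sum_ffunE.
rewrite [RHS](eq_bigr (fun j : 'I_n => \sum_(i < n)
    (X i * (vterm (Y j)^`M(i) j A) - Y i * (vterm (X j)^`M(i) j A)))); last first.
  move=> j _; rewrite ffunE; case: ifPn => Aj.
    by apply: eq_bigr => i _; rewrite !ffunE Aj.
  by rewrite big1 // => i _; rewrite !ffunE (negPf Aj) !mulr0 subr0.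
rewrite [RHS]exchange_big; apply: eq_bigr => i _ /=.
have mvB R Q : (R - Q) A = R A - Q A by rewrite [LHS]ffunE; congr (_ + _); rewrite ffunE.
rewrite mvB rder_vfield lder_vfield !dx_vfield.
rewrite wedge_mvfun wedge_funr [X in _ - X]mulrC /vfield !sum_ffunE.
by rewrite sumrB -!mulr_sumr.
Qed.

End Multivectors.

(* Coordinates on sl(3,K)^*, in the order x12 x13 x21 x23 x31 x32 y13 y23. *)
Definition c12 : 'I_8 := @Ordinal 8 0 isT.
Definition c13 : 'I_8 := @Ordinal 8 1 isT.
Definition c21 : 'I_8 := @Ordinal 8 2 isT.
Definition c23 : 'I_8 := @Ordinal 8 3 isT.
Definition c31 : 'I_8 := @Ordinal 8 4 isT.
Definition c32 : 'I_8 := @Ordinal 8 5 isT.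
Definition cy13 : 'I_8 := @Ordinal 8 6 isT.
Definition cy23 : 'I_8 := @Ordinal 8 7 isT.

Section Sl3.
Variable K : fieldType.

Local Notation x12 := ('X_c12 : {mpoly K[8]}).
Local Notation x13 := ('X_c13 : {mpoly K[8]}).
Local Notation x21 := ('X_c21 : {mpoly K[8]}).
Local Notation x23 := ('X_c23 : {mpoly K[8]}).
Local Notation x31 := ('X_c31 : {mpoly K[8]}).
Local Notation x32 := ('X_c32 : {mpoly K[8]}).
Local Notation y13 := ('X_cy13 : {mpoly K[8]}).
Local Notation y23 := ('X_cy23 : {mpoly K[8]}).
Local Notation "p *d i" := (vterm p i) (at level 40, i at level 0).

(* The matrices E12, E13, E21, E23, E31, E32, E11 - E33, E22 - E33. *)
Definition sl3_basis (i : 'I_8) : 'M[K]_3 :=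
  nth 0 [:: delta_mx 0 1; delta_mx 0 2; delta_mx 1 0; delta_mx 1 2; delta_mx 2 0;
            delta_mx 2 1; delta_mx 0 0 - delta_mx 2 2; delta_mx 1 1 - delta_mx 2 2] i.

(* The linear function on sl(3,K)^* given by a traceless matrix M: as M 2 2 is *)
(* - M 0 0 - M 1 1, its diagonal part is M 0 0 (E11 - E33) + M 1 1 (E22 - E33). *)
Definition sl3_lin (M : 'M[K]_3) : {mpoly K[8]} :=
    M 0 1 *: x12 + M 0 2 *: x13 + M 1 0 *: x21 + M 1 2 *: x23 + M 2 0 *: x31
  + M 2 1 *: x32 + M 0 0 *: y13 + M 1 1 *: y23.

(* {x_M, x_N} = x_[M,N]; since E_ij E_kl = delta_jk E_il, on matrix units this *)
(* reads {x_ij, x_kl} = delta_jk x_il - delta_il x_kj.                         *)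
Definition lie_poisson : mvf K 8 :=
  \sum_(i < 8) \sum_(j < 8 | (i < j)%N)
    wedge (sl3_lin (sl3_basis i *m sl3_basis j - sl3_basis j *m sl3_basis i) *d i)
          (1 *d j).

Definition ham (f : {mpoly K[8]}) : mvf K 8 := schouten lie_poisson (mvfun f).

Definition sl3_submodule (S : mvf K 8 -> Prop) : Prop :=
  [/\ S 0,
      forall (a : K) R Q, S R -> S Q -> S (a *: R + Q)
    & forall (M : 'M[K]_3) R, \tr M = 0 -> S R -> S (schouten (ham (sl3_lin M)) R)].

Definition U27 (f : {mpoly K[8]}) : Prop :=
  forall S : mvf K 8 -> Prop, sl3_submodule S -> S (mvfun (x13 ^+ 2)) -> S (mvfun f).

Definition X0 : mvf K 8 :=
    ((4 * y13 - 2 * y23) * x12 - 6 * x13 * x32) *d c12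
  + ((-4 * y13 + 2 * y23) * x13 + 6 * x12 * x23) *d c13
  + ((2 * y13 - 4 * y23) * x21 + 6 * x23 * x31) *d c21
  + ((-2 * y13 + 4 * y23) * x23 - 6 * x13 * x21) *d c23
  + ((-2 * y13 - 2 * y23) * x31 - 6 * x32 * x21) *d c31
  + ((2 * y13 + 2 * y23) * x32 + 6 * x12 * x31) *d c32
  + (-2 * y13^+2 - 4 * y13 * y23 + 4 * y23^+2) *d cy13
  + (-4 * y13^+2 + 4 * y13 * y23 + 2 * y23^+2) *d cy23.

Definition X1 : mvf K 8 :=
    (-3 * x12^+2) *d c12
  + (6 * x13 * x12) *d c13
  + (-3 * x12 * x21 + 3 * x13 * x31 - 3 * x23 * x32 + y13 * y23 + y23^+2) *d c21
  + (-2 * x13 * y13 + 4 * x13 * y23) *d c23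
  + (3 * x12 * x31 - x32 * y13 + 5 * x32 * y23) *d c31
  + (-3 * x32 * x12) *d c32
  + (2 * x12 * y13 + 5 * x12 * y23 - 3 * x13 * x32) *d cy13
  + (4 * x12 * y13 + x12 * y23 + 3 * x13 * x32) *d cy23.

Definition X2 : mvf K 8 :=
    (-6 * x13 * x12) *d c12
  + (3 * x13^+2) *d c13
  + (-3 * x13 * x21 + x23 * y13 + 4 * x23 * y23) *d c21
  + (3 * x13 * x23) *d c23
  + (-3 * x12 * x21 + 3 * x13 * x31 + 3 * x23 * x32 + y13 * y23 - 2 * y23^+2) *d c31
  + (2 * x12 * y13 + 2 * x12 * y23) *d c32
  + (6 * x12 * x23 + 2 * x13 * y13 + 2 * x13 * y23) *d cy13
  + (3 * x12 * x23 + 4 * x13 * y13 - 5 * x13 * y23) *d cy23.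

Definition X3 : mvf K 8 :=
    (3 * x12 * x21 + 3 * x13 * x31 - 3 * x23 * x32 - y13^+2 - y13 * y23) *d c12
  + (-4 * x23 * y13 + 2 * x23 * y23) *d c13
  + (3 * x21^+2) *d c21
  + (-6 * x23 * x21) *d c23
  + (3 * x31 * x21) *d c31
  + (-3 * x21 * x32 - 5 * x31 * y13 + x31 * y23) *d c32
  + (-x21 * y13 - 4 * x21 * y23 - 3 * x23 * x31) *d cy13
  + (-5 * x21 * y13 - 2 * x21 * y23 + 3 * x23 * x31) *d cy23.

Definition X4 : mvf K 8 :=
    (3 * x12 * x23 - 4 * x13 * y13 - x13 * y23) *d c12
  + (-3 * x13 * x23) *d c13
  + (6 * x23 * x21) *d c21
  + (-3 * x23^+2) *d c23
  + (-2 * x21 * y13 - 2 * x21 * y23) *d c31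
  + (3 * x12 * x21 - 3 * x13 * x31 - 3 * x23 * x32 + 2 * y13^+2 - y13 * y23) *d c32
  + (-3 * x13 * x21 + 5 * x23 * y13 - 4 * x23 * y23) *d cy13
  + (-6 * x13 * x21 - 2 * x23 * y13 - 2 * x23 * y23) *d cy23.

Definition X5 : mvf K 8 :=
    (4 * x32 * y13 - 2 * x32 * y23) *d c12
  + (-3 * x12 * x21 - 3 * x13 * x31 + 3 * x23 * x32 + y13^+2 - 3 * y13 * y23 + 2 * y23^+2) *d c13
  + (-3 * x31 * x21) *d c21
  + (5 * x21 * y13 - 4 * x21 * y23 + 3 * x23 * x31) *d c23
  + (-3 * x31^+2) *d c31
  + (6 * x31 * x32) *d c32
  + (6 * x21 * x32 - 4 * x31 * y13 + 2 * x31 * y23) *d cy13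
  + (3 * x21 * x32 - 5 * x31 * y13 + 7 * x31 * y23) *d cy23.

Definition X6 : mvf K 8 :=
    (3 * x32 * x12) *d c12
  + (4 * x12 * y13 - 5 * x12 * y23 - 3 * x13 * x32) *d c13
  + (2 * x31 * y13 - 4 * x31 * y23) *d c21
  + (3 * x12 * x21 - 3 * x13 * x31 + 3 * x23 * x32 - 2 * y13^+2 + 3 * y13 * y23 - y23^+2) *d c23
  + (-6 * x31 * x32) *d c31
  + (3 * x32^+2) *d c32
  + (-3 * x12 * x31 - 7 * x32 * y13 + 5 * x32 * y23) *d cy13
  + (-6 * x12 * x31 - 2 * x32 * y13 + 4 * x32 * y23) *d cy23.

Definition X7 : mvf K 8 :=
    (-9 * x12^+2) *d c13
  + (-9 * x12 * x31 + 3 * x32 * y13 + 3 * x32 * y23) *d c21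
  + (6 * x12 * y13 - 3 * x12 * y23 + 9 * x13 * x32) *d c23
  + (9 * x32^+2) *d c31
  + (18 * x32 * x12) *d cy13
  + (9 * x32 * x12) *d cy23.

Definition X8 : mvf K 8 :=
    (9 * x13^+2) *d c12
  + (-9 * x23^+2) *d c21
  + (9 * x13 * x21 - 3 * x23 * y13 + 6 * x23 * y23) *d c31
  + (-9 * x12 * x23 - 6 * x13 * y13 + 3 * x13 * y23) *d c32
  + (-9 * x13 * x23) *d cy13
  + (9 * x13 * x23) *d cy23.

Definition X9 : mvf K 8 :=
    (9 * x21 * x32 - 3 * x31 * y13 - 3 * x31 * y23) *d c12
  + (3 * x21 * y13 - 6 * x21 * y23 - 9 * x23 * x31) *d c13
  + (9 * x21^+2) *d c23
  + (-9 * x31^+2) *d c32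
  + (-9 * x31 * x21) *d cy13
  + (-18 * x31 * x21) *d cy23.

Definition Xb (b : 10.-tuple K) : mvf K 8 :=
  \sum_(i < 10) b`_i *: [:: X0; X1; X2; X3; X4; X5; X6; X7; X8; X9]`_i.

Definition Qform (b : seq K) : {mpoly K[8]} :=
  let b0 := b`_0 in let b1 := b`_1 in let b2 := b`_2 in let b3 := b`_3 in
  let b4 := b`_4 in let b5 := b`_5 in let b6 := b`_6 in let b7 := b`_7 in
  let b8 := b`_8 in let b9 := b`_9 in
    (-4 * b2 * b4 - 12 * b5 * b7) *: (x21 * x13)
  + (12 * b0 * b7 - 8 * b2 * b3) *: (x23 * x13)
  + (-b0^+2 + 4 * b1 * b4 - 4 * b2 * b5 + 4 * b3 * b6) *: (x13 * x31)
  + (-4 * b2 * b6 - 12 * b3 * b8) *: (x13 * x32)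
  + (-4 * b0 * b2 - 4 * b1 * b3 + 12 * b6 * b7) *: (y13 * x13)
  + (12 * b5 * b8 + 4 * b6^+2) *: (x32^+2)
  + (4 * b0 * b6 + 8 * b1 * b5) *: (y23 * x32)
  + (b0^+2 - 4 * b3 * b6) *: (y13^+2)
  + (-b0^+2 - 4 * b1 * b4 + 4 * b2 * b5 + 4 * b3 * b6) *: (y23 * y13)
  + (b0^+2 - 4 * b2 * b5) *: (y23^+2)
  + (-12 * b1 * b9 - 4 * b4 * b6) *: (y23 * x31)
  + (4 * b5^+2 + 12 * b6 * b9) *: (x31^+2)
  + (4 * b3^+2 + 12 * b4 * b7) *: (x23^+2)
  + (-4 * b0 * b3 - 4 * b2 * b4 + 12 * b5 * b7) *: (y23 * x23)
  + (-4 * b0 * b4 + 12 * b2 * b9 - 4 * b3 * b5) *: (y23 * x21)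
  + (12 * b3 * b9 + 4 * b4^+2) *: (x21^+2)
  + (-4 * b1 * b3 - 12 * b6 * b7) *: (y23 * x13)
  + (12 * b1 * b7 + 4 * b2^+2) *: (x13^+2)
  + (4 * b0 * b1 + 8 * b2 * b6) *: (y23 * x12)
  + (4 * b1^+2 + 12 * b2 * b8) *: (x12^+2)
  + (-4 * b1 * b5 - 12 * b4 * b8) *: (x32 * y13)
  + (4 * b5 * b6 - 36 * b8 * b9) *: (x32 * x31)
  + (4 * b0 * b5 + 8 * b4 * b6) *: (y13 * x31)
  + (-12 * b2 * b9 - 4 * b3 * b5) *: (x23 * x31)
  + (-b0^+2 + 4 * b1 * b4 + 4 * b2 * b5 - 4 * b3 * b6) *: (x23 * x32)
  + (-4 * b2 * b4 - 12 * b5 * b7) *: (x23 * y13)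
  + (-4 * b1 * b3 - 12 * b6 * b7) *: (x12 * x23)
  + (-4 * b1 * b5 - 12 * b4 * b8) *: (x31 * x12)
  + (12 * b0 * b8 - 8 * b1 * b6) *: (x32 * x12)
  + (-4 * b0 * b1 - 4 * b2 * b6 + 12 * b3 * b8) *: (x12 * y13)
  + (4 * b1 * b2 - 36 * b7 * b8) *: (x12 * x13)
  + (-b0^+2 - 4 * b1 * b4 + 4 * b2 * b5 + 4 * b3 * b6) *: (x12 * x21)
  + (4 * b3 * b4 - 36 * b7 * b9) *: (x21 * x23)
  + (12 * b0 * b9 - 8 * b4 * b5) *: (x31 * x21)
  + (-12 * b1 * b9 - 4 * b4 * b6) *: (x32 * x21)
  + (4 * b0 * b4 + 8 * b3 * b5) *: (x21 * y13).

(* The coefficients of Qform refer to the weight vectors                       *)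
(*   X0 / 2, X1, X2, X4, X3, X5, X6, X8, X7, X9  (in this order);              *)
(* for instance b3^2 multiplies x23^2, of weight 2 (e2 - e3), and the vector   *)
(* of weight e2 - e3 is X4, not X3.  Hence the substitution below.  The factor *)
(* -9 is the one imposed by the normalization of the Schouten bracket.         *)
Definition Qb (b : 10.-tuple K) : {mpoly K[8]} :=
  (-9 : K) *: Qform [:: 2 * b`_0; b`_1; b`_2; b`_4; b`_3; b`_5; b`_6; b`_8; b`_7; b`_9].

End Sl3.

(* Main.v *)
From Stdlib Require Import BinInt.
Require Import Defs.
From mathcomp Require Import all_boot all_order all_algebra.
From mathcomp Require Import reals mpoly.
From mathcomp Require Import ring ssrZ.

(** Write [P] for the Lie-Poisson bivector.  Both sides of the identity are
    quadratic in [b]: with [q_ij] the second derivative of [Q_b] in [b_i], [b_j],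
    the claim is that the trivectors
      [D_ij = [[X_i, P], [X_j, P]] - [P, q_ij] /\ P]
    vanish for all [i], [j].  There are 100 of them, but one suffices.

    The hamiltonian vector field [Y] of a linear function preserves [P], and the
    Lie derivative along a vector field is a derivation of the wedge product
    ([schouten_vf_wedge]) and of the Schouten bracket ([schouten_vf_jacobi]).
    If [Y] belongs to a root vector, it maps each [X_i] to a multiple of some
    [X_k], all weights of [S^3(V^* )] being simple, and [q] is equivariant; so
    [(X_i, X_j) |-> D_ij] is an equivariant map on the tensor square of [W^*]
    ([vf_defect]).  As a module, this square is generated by [X_8 (x) X_7], the
    product of two different extreme weight vectors, that is, of a highest and a
    lowest one for a suitable choice of positive roots: root vectors annihilating
    [X_8] lead from [X_7] to all the [X_j], which gives all [X_8 (x) X_j], and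
    others then move the first factor ([extreme_pair_generates]).  So it is
    enough that [D_87 = 0], a short computation.

    The same argument gives the membership in [U]: the [q_ij] also form an
    equivariant family, and [q_87] is a multiple of [x_12 x_13], which is
    proportional to the derivative of [x_13^2] along the field of [x_32].

    The explicit identities left over (the action of four root vectors on [P],
    the [X_i] and the [q_ij], and [D_87 = 0]) are evaluated on lists of terms
    with integer coefficients ([ev], [bracketE], [ev_eq]). *)

Set Implicit Arguments.
Unset Strict Implicit.
Unset Printing Implicit Defensive.

Import GRing.Theory Num.Theory.
Local Open Scope ring_scope.

(** * The Schouten bracket with a vector field *)

Section Multivectors.
Variables (K : fieldType) (n : nat).
Implicit Types (R Q S Y : mvf K n) (A B C : {set 'I_n}).

Lemma wedgeNl R Q : wedge (- R) Q = - wedge R Q.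
Proof. by rewrite -scaleN1r wedgeZl scaleN1r. Qed.

Lemma wedgeNr R Q : wedge R (- Q) = - wedge R Q.
Proof. by rewrite -scaleN1r wedgeZr scaleN1r. Qed.

Lemma wedge_suml I (r : seq I) (F : I -> mvf K n) Q :
  wedge (\sum_(i <- r) F i) Q = \sum_(i <- r) wedge (F i) Q.
Proof. by apply: (big_morph (fun R => wedge R Q)) => [x y|]; rewrite ?wedgeDl ?wedge0l. Qed.

Lemma wedge_sumr I (r : seq I) (F : I -> mvf K n) R :
  wedge R (\sum_(i <- r) F i) = \sum_(i <- r) wedge R (F i).
Proof. by apply: (big_morph (fun Q => wedge R Q)) => [x y|]; rewrite ?wedgeDr ?wedge0r. Qed.

Lemma dxZ i (a : K) R : dx i (a *: R) = a *: dx i R.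
Proof. by apply/ffunP => A; rewrite !ffunE mderivZ. Qed.

Lemma lderZ i (a : K) R : lder i (a *: R) = a *: lder i R.
Proof.
by apply/ffunP => A; rewrite !ffunE; case: ifP; rewrite ?scaler0 // scalerAr.
Qed.

Lemma rderZ i (a : K) R : rder i (a *: R) = a *: rder i R.
Proof.
by apply/ffunP => A; rewrite !ffunE; case: ifP; rewrite ?scaler0 // scalerAr.
Qed.

Lemma dx0 i : dx i (0 : mvf K n) = 0.
Proof. by rewrite -(scale0r 0) dxZ !scale0r. Qed.

Lemma lder_0 i : lder i (0 : mvf K n) = 0.
Proof. by rewrite -(scale0r 0) lderZ !scale0r. Qed.

Lemma rder_0 i : rder i (0 : mvf K n) = 0.
Proof. by rewrite -(scale0r 0) rderZ !scale0r. Qed.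

Lemma dx_sum i I (r : seq I) (F : I -> mvf K n) :
  dx i (\sum_(j <- r) F j) = \sum_(j <- r) dx i (F j).
Proof. by apply: (big_morph (fun Q => dx i Q)) => [x y|]; rewrite ?dxD ?dx0. Qed.

Lemma lder_sum i I (r : seq I) (F : I -> mvf K n) :
  lder i (\sum_(j <- r) F j) = \sum_(j <- r) lder i (F j).
Proof. by apply: (big_morph (fun Q => lder i Q)) => [x y|]; rewrite ?lderD ?lder_0. Qed.

Lemma rder_sum i I (r : seq I) (F : I -> mvf K n) :
  rder i (\sum_(j <- r) F j) = \sum_(j <- r) rder i (F j).
Proof. by apply: (big_morph (fun Q => rder i Q)) => [x y|]; rewrite ?rderD ?rder_0. Qed.

Lemma schoutenZl (a : K) R Q : schouten (a *: R) Q = a *: schouten R Q.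
Proof.
rewrite /schouten scaler_sumr; apply: eq_bigr => i _.
by rewrite rderZ dxZ !wedgeZl scalerBr.
Qed.

Lemma schoutenZr (a : K) R Q : schouten R (a *: Q) = a *: schouten R Q.
Proof.
rewrite /schouten scaler_sumr; apply: eq_bigr => i _.
by rewrite lderZ dxZ !wedgeZr scalerBr.
Qed.

Lemma schouten0l Q : schouten 0 Q = 0.
Proof. by rewrite -[X in schouten X](scale0r 0) schoutenZl scale0r. Qed.

Lemma schouten0r Q : schouten Q 0 = 0.
Proof. by rewrite -[X in schouten _ X](scale0r 0) schoutenZr scale0r. Qed.

Lemma schouten_suml I (r : seq I) (F : I -> mvf K n) Q :
  schouten (\sum_(i <- r) F i) Q = \sum_(i <- r) schouten (F i) Q.
Proof. by apply: (big_morph (fun R => schouten R Q)) => [x y|]; rewrite ?schoutenDl ?schouten0l. Qed.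

Lemma schouten_sumr I (r : seq I) (F : I -> mvf K n) R :
  schouten R (\sum_(i <- r) F i) = \sum_(i <- r) schouten R (F i).
Proof. by apply: (big_morph (fun Q => schouten R Q)) => [x y|]; rewrite ?schoutenDr ?schouten0r. Qed.

Lemma schoutenNr R Q : schouten R (- Q) = - schouten R Q.
Proof. by rewrite -scaleN1r schoutenZr scaleN1r. Qed.

Lemma of_deg0 r : of_deg r (0 : mvf K n).
Proof. by move=> A; rewrite ffunE eqxx. Qed.

Lemma of_degD r R Q : of_deg r R -> of_deg r Q -> of_deg r (R + Q).
Proof.
move=> /of_degP dR /of_degP dQ; apply/of_degP => A nA.
by rewrite ffunE dR // dQ // addr0.
Qed.

Lemma of_degZ r (a : K) R : of_deg r R -> of_deg r (a *: R).
Proof. by move=> /of_degP dR; apply/of_degP => A nA; rewrite ffunE dR // scaler0. Qed.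

Lemma of_deg_wedge r q R Q : of_deg r R -> of_deg q Q -> of_deg (r + q) (wedge R Q).
Proof.
move=> /of_degP dR /of_degP dQ; apply/of_degP => C nC.
rewrite ffunE big1 // => A sAC.
have [eA|/dR ->] := eqVneq #|A| r; last by rewrite mul0r mulr0.
rewrite dQ ?mulr0 //; apply: contraNneq nC => eQ.
by rewrite -eA -eQ cardsDS // subnKC // subset_leq_card.
Qed.

Lemma dx_dx i k R : dx i (dx k R) = dx k (dx i R).
Proof. by apply/ffunP => A; rewrite !ffunE mderiv_comm. Qed.

Lemma dx_lder i k R : dx i (lder k R) = lder k (dx i R).
Proof.
apply/ffunP => A; rewrite !ffunE; case: ifP => _; first by rewrite mderiv0.
by rewrite -!signZ mderivZ.
Qed.

Lemma dx_rder i k R : dx i (rder k R) = rder k (dx i R).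
Proof.
apply/ffunP => A; rewrite !ffunE; case: ifP => _; first by rewrite mderiv0.
by rewrite -!signZ mderivZ.
Qed.

Lemma lder_lder i k R : lder i (lder k R) = - lder k (lder i R).
Proof.
apply/ffunP => A; rewrite [RHS]ffunE !ffunE !in_setU1.
have [<-|ik] := eqVneq i k.
  by rewrite /= mulr0 if_same oppr0.
rewrite /=.
case: (boolP (i \in A)) => iA; case: (boolP (k \in A)) => kA;
  rewrite ?mulr0 ?oppr0 //.
rewrite setUCA !mulrA -mulNr; congr (_ * _).
rewrite !invUr ?disjoints1 // !exprD.
have : (Defs.inv [set i] [set k] + Defs.inv [set k] [set i] = 1)%N.
  by rewrite inv_swap ?disjoints1 ?inE ?cards1.
case: (Defs.inv [set i] [set k]) => [|[|?]]; case: (Defs.inv [set k] [set i]) => [|[|?]] //= _;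
  by rewrite !(expr0, expr1); ring.
Qed.

Lemma dx_schouten i R Q : dx i (schouten R Q) = schouten (dx i R) Q + schouten R (dx i Q).
Proof.
rewrite /schouten dx_sum -big_split; apply: eq_bigr => k _ /=.
rewrite dxD -scaleN1r dxZ scaleN1r !dx_wedge dx_rder dx_lder !(dx_dx i k).
by rewrite opprD addrACA.
Qed.

Lemma wedge0C R Q : of_deg 0 R -> wedge R Q = wedge Q R.
Proof.
move=> /of_degP dR; apply/ffunP => C; rewrite !wedgeE exchange_big.
apply: eq_bigr => B _; apply: eq_bigr => A _; rewrite sg_swap.
have [->|/dR ->] := eqVneq #|A| 0%N; first by rewrite expr0 mul1r mulrCA mulrC mulrA.
by rewrite mul0r !mulr0.
Qed.

Section VectorField.
Variable Y : mvf K n.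
Hypothesis dY : of_deg 1 Y.

Let dlY i : of_deg 0 (lder i Y).
Proof. exact: (of_deg_lder (i := i) dY). Qed.

Lemma schouten_vfE Q :
  schouten Y Q = \sum_(k < n) (wedge (lder k Y) (dx k Q) - wedge (dx k Y) (lder k Q)).
Proof.
by apply: eq_bigr => k _; rewrite (rder_lder k dY) -signr_odd expr0 scale1r.
Qed.

Lemma of_deg_schouten_vf r R : of_deg r R -> of_deg r (schouten Y R).
Proof.
move=> dR; rewrite schouten_vfE; elim/big_ind: _ => [||k _]; first exact: of_deg0.
  by move=> ? ?; apply: of_degD.
apply: of_degD; first exact: (of_deg_wedge (dlY (i := k)) (of_deg_dx dR)).
rewrite -scaleN1r; apply: of_degZ.
case: r dR => [|r] dR; first by rewrite (lder0 k dR) wedge0r; apply: of_deg0.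
exact: (of_deg_wedge (of_deg_dx dY) (of_deg_lder dR)).
Qed.

Lemma schouten_vf_wedge r Q S : of_deg r Q ->
  schouten Y (wedge Q S) = wedge (schouten Y Q) S + wedge Q (schouten Y S).
Proof.
by move=> dQ; rewrite (schouten_leibniz S dY dQ) -signr_odd oddM /= expr0 scale1r.
Qed.

Lemma schouten_vf_lder i Q :
  schouten Y (lder i Q) =
  lder i (schouten Y Q) + \sum_(k < n) wedge (dx k (lder i Y)) (lder k Q).
Proof.
rewrite !schouten_vfE lder_sum -big_split; apply: eq_bigr => k _ /=.
rewrite lderD -[- wedge _ _ in RHS]scaleN1r lderZ scaleN1r.
rewrite (lder_wedge i _ (dlY (i := k))) (lder_wedge i _ (of_deg_dx dY)).
rewrite (lder0 i (dlY (i := k))) wedge0l add0r expr0 scale1r expr1 scaleN1r.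
rewrite dx_lder [lder i (dx k Y)](_ : _ = dx k (lder i Y)) ?dx_lder //.
rewrite [lder i (lder k Q)]lder_lder wedgeNr opprK opprD.
by rewrite -dx_lder addrA addrAC subrK.
Qed.

Lemma schouten_vf_rder i r R : of_deg r R ->
  schouten Y (rder i R) =
  rder i (schouten Y R) + \sum_(k < n) wedge (dx k (lder i Y)) (rder k R).
Proof.
move=> dR; rewrite (rder_lder i dR) (rder_lder i (of_deg_schouten_vf dR)).
rewrite schoutenZr schouten_vf_lder scalerDr scaler_sumr; congr (_ + _).
by apply: eq_bigr => k _; rewrite (rder_lder k dR) wedgeZr.
Qed.

(** The Lie derivative [schouten Y] is a derivation of the wedge product and
    commutes with the partial derivatives and the contractions up to terms in the
    first and second derivatives of [Y].  In the bracket of [R] and [Q], the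
    former cancel in pairs, the latter by symmetry of the second derivatives. *)
Lemma schouten_vf_jacobi r R Q : of_deg r R ->
  schouten Y (schouten R Q) =
  schouten (schouten Y R) Q + schouten R (schouten Y Q).
Proof.
move=> dR.
pose a i k := dx k (lder i Y); pose h i k := dx i (dx k Y).
have da i k : of_deg 0 (a i k) by apply: of_deg_dx.
have dxY i S : schouten (dx i Y) S =
    \sum_k wedge (a k i) (dx k S) - \sum_k wedge (h k i) (lder k S).
  rewrite -sumrB; apply: eq_bigr => k _.
  by rewrite (rder_lder k (of_deg_dx dY)) -signr_odd expr0 scale1r -dx_lder.
have Ldx i S : schouten Y (dx i S) =
    dx i (schouten Y S) - (\sum_k wedge (a k i) (dx k S) - \sum_k wedge (h k i) (lder k S)).
  by rewrite -dxY dx_schouten addrC addKr.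
(* [A1], [A2] and their primed partners carry the first derivatives of [Y], [H]
   and [H'] the second ones; each pair differs by a transposition of [i] and [k]. *)
pose A1 i := \sum_k wedge (wedge (a i k) (rder k R)) (dx i Q).
pose A1' i := \sum_k wedge (rder i R) (wedge (a k i) (dx k Q)).
pose A2 i := \sum_k wedge (wedge (a k i) (dx k R)) (lder i Q).
pose A2' i := \sum_k wedge (dx i R) (wedge (a i k) (lder k Q)).
pose H i := \sum_k wedge (rder i R) (wedge (h k i) (lder k Q)).
pose H' i := \sum_k wedge (wedge (h k i) (lder k R)) (lder i Q).
have eA1 : \sum_i A1 i = \sum_i A1' i.
  rewrite exchange_big; apply: eq_bigr => i _; apply: eq_bigr => k _.
  by rewrite (wedge0C _ (da k i)) wedgeA.
have eA2 : \sum_i A2 i = \sum_i A2' i.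
  rewrite exchange_big; apply: eq_bigr => i _; apply: eq_bigr => k _.
  by rewrite (wedge0C _ (da i k)) wedgeA.
have eH : \sum_i H i = \sum_i H' i.
  rewrite [RHS]exchange_big; apply: eq_bigr => i _; apply: eq_bigr => k _.
  rewrite -wedgeA /h dx_dx; congr wedge; case: r dR => [|r] dR.
    by rewrite (rder0 i dR) (lder0 i dR) wedge0l wedge0r.
  rewrite (wedgeC (of_deg_rder (i := i) dR) (of_deg_dx (of_deg_dx dY))).
  rewrite (rder_lder i dR) wedgeZr scalerA muln1 -exprD -signr_odd oddD.
  by rewrite /= negbK addbb scale1r.
rewrite [schouten R Q]/schouten schouten_sumr [schouten (schouten Y R) Q]/schouten.
rewrite [schouten R (schouten Y Q)]/schouten -big_split /=.
transitivity (\sum_i ((wedge (rder i (schouten Y R)) (dx i Q)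
    - wedge (dx i (schouten Y R)) (lder i Q)
    + (wedge (rder i R) (dx i (schouten Y Q)) - wedge (dx i R) (lder i (schouten Y Q))))
    + ((A1 i - A1' i) + (H i - H' i) + (A2 i - A2' i)))); last first.
  rewrite big_split /= -[RHS]addr0; congr (_ + _).
  by rewrite !big_split /= !sumrN eA1 eA2 eH !subrr !addr0.
apply: eq_bigr => i _; rewrite schoutenDr schoutenNr.
rewrite (schouten_vf_wedge _ (of_deg_rder (i := i) dR)) (schouten_vf_wedge _ (of_deg_dx dR)).
rewrite (schouten_vf_rder i dR) schouten_vf_lder !Ldx.
rewrite !(wedgeDl, wedgeDr, wedgeNl, wedgeNr) !(wedge_suml, wedge_sumr).
rewrite -/(A1 i) -/(A1' i) -/(A2 i) -/(A2' i) -/(H i) -/(H' i).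
rewrite !opprD !opprK !addrA.
by rewrite [LHS](ACl (1*6*3*9*2*4*5*8*7*10)).
Qed.
End VectorField.

Lemma of_deg_schouten_fun r (R f : mvf K n) :
  of_deg r.+1 R -> of_deg 0 f -> of_deg r (schouten R f).
Proof.
move=> dR df; rewrite /schouten; elim/big_ind: _ => [||i _]; first exact: of_deg0.
  by move=> ? ?; apply: of_degD.
rewrite (lder0 i df) wedge0r subr0 -[r]addn0.
exact: (of_deg_wedge (of_deg_rder dR) (of_deg_dx df)).
Qed.

End Multivectors.

(** * The bracket defect *)

Section Defect.
Variables (K : fieldType) (n : nat).
Implicit Types P X Y f : mvf K n.

(** On [X_i], [X_j] and [q_ij], its vanishing is the polarized identity. *)
Definition bracket_defect P X1 X2 f : mvf K n :=
  schouten (schouten X1 P) (schouten X2 P) - wedge (schouten P f) P.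

(** Each of the two terms is a natural operation on [X1], [X2], [f] and [P], so a
    field preserving [P] acts by the product rule.  The coefficients [a1], [a2]
    must be shared between the [Xi] and [f] for the parts to recombine. *)
Lemma vf_defect Y P X1 X2 f a1 a2 X1' X2' f1 f2 :
  of_deg 1 Y -> of_deg 2 P -> of_deg 1 X1 -> of_deg 1 X2 -> of_deg 0 f ->
  schouten Y P = 0 ->
  schouten Y X1 = a1 *: X1' -> schouten Y X2 = a2 *: X2' ->
  schouten Y f = a1 *: f1 + a2 *: f2 ->
  schouten Y (bracket_defect P X1 X2 f) =
  a1 *: bracket_defect P X1' X2 f1 + a2 *: bracket_defect P X1 X2' f2.
Proof.
move=> dY dP dX1 dX2 df YP YX1 YX2 Yf; rewrite /bracket_defect schoutenDr schoutenNr.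
rewrite (schouten_vf_jacobi dY _ (of_deg_schouten_vf dX1 dP)).
rewrite (schouten_vf_jacobi dY P dX1) (schouten_vf_jacobi dY P dX2) YP YX1 YX2.
rewrite (schouten0r X1) (schouten0r X2) !addr0.
rewrite (schouten_vf_wedge dY _ (of_deg_schouten_fun dP df)) YP wedge0r addr0.
rewrite (schouten_vf_jacobi dY f dP) YP schouten0l add0r Yf.
rewrite (schoutenZl a1 X1' P) (schoutenZl a2 X2' P) schoutenZl schoutenZr.
rewrite (schoutenDr P) (schoutenZr a1 P) (schoutenZr a2 P) wedgeDl !wedgeZl.
by rewrite !scalerBr opprD addrACA.
Qed.
End Defect.

(** * Computing with lists of terms *)

Delimit Scope Z_scope with zz.

(** [(c, (m, s))] stands for [c] times the product of the even variables in [m]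
    times the wedge product of the odd variables [d_k], [k] in [s].  Even variables
    below 8 are the coordinates; [8 + k] is the parameter [b_k], a constant for
    the derivations. *)
Definition term : Type := (Z * (seq nat * seq nat))%type.
Definition terms : Type := seq term.

Section Semantics.
Variables (K : numFieldType) (par : seq K).
Local Notation mv := (mvf K 8).
Implicit Types (c d : Z) (m s : seq nat) (t u : term) (p q : terms).

(** The coefficients are binary integers because the identities are evaluated. *)
Definition scal c : K := (int_of_Z c)%:~R.

Definition even_var (k : nat) : {mpoly K[8]} :=
  if insub k is Some i then 'X_i else (par`_(k - 8))%:MP.

Definition odd_var (k : nat) : mv :=
  if insub k is Some i then vterm 1 i else 0.

Definition even_mon m : {mpoly K[8]} := \prod_(k <- m) even_var k.

Definition odd_mon s : mv := foldr (fun k R => wedge (odd_var k) R) (mvfun 1) s.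

Definition ev_term t : mv := scal t.1 *: wedge (mvfun (even_mon t.2.1)) (odd_mon t.2.2).

Definition ev p : mv := \sum_(t <- p) ev_term t.

Lemma scalD c d : scal (c + d)%zz = scal c + scal d.
Proof. by rewrite /scal -intrD -rmorphD. Qed.

Lemma scalM c d : scal (c * d)%zz = scal c * scal d.
Proof. by rewrite /scal -intrM -rmorphM. Qed.

Lemma scalN c : scal (- c)%zz = - scal c.
Proof. by rewrite /scal -mulrNz -rmorphN. Qed.

Lemma scal_nat n : scal (Z.of_nat n) = n%:R.
Proof. by rewrite /scal; case: n => //= n; rewrite SuccNat2Pos.id_succ. Qed.

Lemma ev_nil : ev [::] = 0. Proof. by rewrite /ev big_nil. Qed.
Lemma ev_cons t p : ev (t :: p) = ev_term t + ev p. Proof. by rewrite /ev big_cons. Qed.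
Lemma ev_cat p q : ev (p ++ q) = ev p + ev q. Proof. by rewrite /ev big_cat. Qed.
Lemma ev1 t : ev [:: t] = ev_term t. Proof. by rewrite ev_cons ev_nil addr0. Qed.

Lemma mvfunM f g : mvfun (f * g) = wedge (mvfun f) (mvfun g) :> mv.
Proof. by apply/ffunP => A; rewrite wedge_mvfun !ffunE; case: ifP; rewrite ?mulr0. Qed.

Lemma mvfunD f g : mvfun (f + g) = mvfun f + mvfun g :> mv.
Proof. by apply/ffunP => A; rewrite !ffunE; case: ifP; rewrite ?addr0. Qed.

Lemma mvfunZ (a : K) f : mvfun (a *: f) = a *: mvfun f :> mv.
Proof. by apply/ffunP => A; rewrite !ffunE; case: ifP; rewrite ?scaler0. Qed.

Lemma wedge1l (R : mv) : wedge (mvfun 1) R = R.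
Proof. by apply/ffunP => A; rewrite wedge_mvfun mul1r. Qed.

Lemma vtermE f i : vterm f i = wedge (mvfun f) (vterm 1 i) :> mv.
Proof. by apply/ffunP => A; rewrite wedge_mvfun !ffunE; case: ifP; rewrite ?mulr1 ?mulr0. Qed.

Lemma vterm_vfield i : vterm 1 i = vfield (fun j => (j == i)%:R) :> mv.
Proof.
rewrite /vfield (bigD1 i) //= eqxx big1 ?addr0 // => j /negPf ->.
by apply/ffunP => A; rewrite !ffunE if_same.
Qed.

Lemma odd_varE (i : 'I_8) : odd_var i = vterm 1 i.
Proof. by rewrite /odd_var valK. Qed.

Lemma even_varE (i : 'I_8) : even_var i = 'X_i.
Proof. by rewrite /even_var valK. Qed.

Lemma of_deg_odd_var k : of_deg 1 (odd_var k).
Proof.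
rewrite /odd_var; case: insubP => [i _ _|_]; last exact: of_deg0.
by rewrite vterm_vfield; apply: of_deg_vfield.
Qed.

Lemma of_deg_odd_mon s : of_deg (size s) (odd_mon s).
Proof.
elim: s => [|k s IH]; first exact: of_deg_mvfun.
exact: (of_deg_wedge (of_deg_odd_var (k := k)) IH).
Qed.

Lemma of_deg_ev_term t : of_deg (size t.2.2) (ev_term t).
Proof.
apply: of_degZ.
exact: (of_deg_wedge (@of_deg_mvfun _ _ _) (@of_deg_odd_mon t.2.2)).
Qed.

Definition has_deg r p := all (fun t => size t.2.2 == r) p.

Lemma of_deg_ev r p : has_deg r p -> of_deg r (ev p).
Proof.
elim: p => [_|t p IH /= /andP[/eqP dt dp]]; first by rewrite ev_nil; apply: of_deg0.
by rewrite ev_cons; apply: of_degD (IH dp); rewrite -dt; apply: of_deg_ev_term.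
Qed.

Lemma odd_varC j k : wedge (odd_var j) (odd_var k) = - wedge (odd_var k) (odd_var j).
Proof.
by rewrite (wedgeC (of_deg_odd_var (k := j)) (of_deg_odd_var (k := k))) expr1 scaleN1r.
Qed.

(** A consequence of anticommutation, as 2 is invertible in [K]. *)
Lemma odd_var2 k : wedge (odd_var k) (odd_var k) = 0.
Proof.
have /eqP := odd_varC k k; rewrite -addr_eq0 -mulr2n -scaler_nat scaler_eq0.
by rewrite pnatr_eq0 => /eqP.
Qed.

(** The first component is the sign of the permutation, or 0 if [k] occurs twice. *)
Fixpoint insert_odd k s : Z * seq nat :=
  if s is j :: s' then
    if (k < j)%N then (1%zz, k :: s) else
    if k == j then (0%zz, s) else
    let r := insert_odd k s' in ((- r.1)%zz, j :: r.2)
  else (1%zz, [:: k]).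

Lemma scal0 : scal 0 = 0. Proof. by []. Qed.
Lemma scal1 : scal 1 = 1. Proof. by []. Qed.

Lemma insert_oddE k s :
  wedge (odd_var k) (odd_mon s) = scal (insert_odd k s).1 *: odd_mon (insert_odd k s).2.
Proof.
elim: s => [|j s IH] /=; first by rewrite scal1 scale1r.
case: ifP => _; first by rewrite scal1 scale1r.
case: eqP => [->|_] /=; first by rewrite -wedgeA odd_var2 wedge0l scal0 scale0r.
by rewrite -wedgeA odd_varC wedgeNl wedgeA IH wedgeZr scalN scaleNr.
Qed.

Definition sort_odd s : Z * seq nat :=
  foldr (fun k r => let r' := insert_odd k r.2 in ((r.1 * r'.1)%zz, r'.2)) (1%zz, [::]) s.

Lemma sort_oddE s : odd_mon s = scal (sort_odd s).1 *: odd_mon (sort_odd s).2.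
Proof.
elim: s => [|k s IH] /=; first by rewrite scal1 scale1r.
by rewrite IH wedgeZr insert_oddE scalerA scalM.
Qed.

Definition normal_term t : term :=
  let r := sort_odd t.2.2 in ((t.1 * r.1)%zz, (sort leq t.2.1, r.2)).

Lemma normal_termE t : ev_term (normal_term t) = ev_term t.
Proof.
case: t => c [m s]; rewrite /ev_term /= [odd_mon s in RHS]sort_oddE wedgeZr scalerA scalM.
congr (_ *: wedge (mvfun _) _).
by apply: perm_big; rewrite perm_sort.
Qed.

Fixpoint collect t p : terms :=
  if p is u :: p' then
    if t.2 == u.2 then
      let c := (t.1 + u.1)%zz in if Z.eqb c 0 then p' else (c, u.2) :: p'
    else u :: collect t p'
  else if Z.eqb t.1 0 then [::] else [:: t].

Lemma collectE t p : ev (collect t p) = ev_term t + ev p.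
Proof.
elim: p => [|u p IH] /=.
  rewrite ev_nil addr0; case: Z.eqb_spec => [c0|_]; last by rewrite ev1.
  by rewrite /ev_term c0 scal0 scale0r ev_nil.
case: eqP => [e|_]; last by rewrite !ev_cons IH addrCA.
have E : ev_term t + ev (u :: p) = scal (t.1 + u.1)%zz *: ev_term (1%zz, u.2) + ev p.
  by rewrite ev_cons addrA /ev_term e scal1 scale1r -scalerDl scalD.
case: Z.eqb_spec => [c0|_]; first by rewrite E c0 scal0 scale0r add0r.
by rewrite E ev_cons {2}/ev_term scal1 scale1r.
Qed.

Definition normal_form p : terms := foldr (fun t => collect (normal_term t)) [::] p.

Lemma normal_formE p : ev (normal_form p) = ev p.
Proof. by elim: p => //= t p IH; rewrite collectE normal_termE IH ev_cons. Qed.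

Definition scale_term c t : term := ((c * t.1)%zz, t.2).
Definition scale_terms c p : terms := [seq scale_term c t | t <- p].

Lemma ev_scale c p : ev (scale_terms c p) = scal c *: ev p.
Proof.
elim: p => [|t p IH] /=; first by rewrite ev_nil scaler0.
by rewrite !ev_cons IH scalerDr /ev_term scalM scalerA.
Qed.

Definition mul_term t u : term := ((t.1 * u.1)%zz, (t.2.1 ++ u.2.1, t.2.2 ++ u.2.2)).

Definition mul_terms p q : terms := normal_form [seq mul_term t u | t <- p, u <- q].

Lemma odd_mon_cat s s' : odd_mon (s ++ s') = wedge (odd_mon s) (odd_mon s').
Proof. by elim: s => [|k s IH] /=; rewrite ?wedge1l // IH wedgeA. Qed.

Lemma even_mon_cat m m' : even_mon (m ++ m') = even_mon m * even_mon m'.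
Proof. exact: big_cat. Qed.

Lemma mul_termE t u : ev_term (mul_term t u) = wedge (ev_term t) (ev_term u).
Proof.
rewrite /ev_term /= scalM even_mon_cat odd_mon_cat mvfunM wedgeZl wedgeZr scalerA.
congr (_ *: _); rewrite -!wedgeA; congr wedge; rewrite !wedgeA; congr wedge.
by rewrite wedge0C //; apply: of_deg_mvfun.
Qed.

Lemma ev_mul p q : ev (mul_terms p q) = wedge (ev p) (ev q).
Proof.
rewrite normal_formE; elim: p => [|t p IH] /=; first by rewrite ev_nil wedge0l.
rewrite ev_cat IH ev_cons wedgeDl; congr (_ + _).
elim: q {IH} => [|u q IH] /=; first by rewrite ev_nil wedge0r.
by rewrite !ev_cons wedgeDr IH mul_termE.
Qed.

Definition deriv_term k t : terms :=
  if k \in t.2.1 then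
    [:: ((t.1 * Z.of_nat (count_mem k t.2.1))%zz, (rem k t.2.1, t.2.2))]
  else [::].
Definition deriv_terms k p : terms := flatten [seq deriv_term k t | t <- p].

Fixpoint contract k s : seq (Z * seq nat) :=
  if s is j :: s' then
    (if j == k then [:: (1%zz, s')] else [::])
      ++ [seq ((- r.1)%zz, j :: r.2) | r <- contract k s']
  else [::].

Definition contract_term k t : terms :=
  [seq ((t.1 * r.1)%zz, (t.2.1, r.2)) | r <- contract k t.2.2].

Definition left_contract k p : terms := flatten [seq contract_term k t | t <- p].

(** For a monomial [R] of degree [r], the right derivative is [(-1)^(r-1)] times
    the left one. *)
Definition right_contract k p : terms :=
  flatten [seq scale_terms (if odd (size t.2.2) then 1 else -1)%zz (contract_term k t) | t <- p].

Definition bracket p q : terms :=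
  normal_form (flatten
    [seq mul_terms (right_contract k p) (deriv_terms k q)
         ++ scale_terms (-1)%zz (mul_terms (deriv_terms k p) (left_contract k q))
    | k <- index_iota 0 8]).

Lemma mderiv_even_var (i : 'I_8) k : (even_var k)^`M(i) = (k == i)%:R.
Proof.
rewrite /even_var; case: insubP => [j _ <-|kge]; last first.
  by rewrite mderivC; case: eqP => // e; rewrite e ltn_ord in kge.
rewrite mderivX mnm1E -val_eqE; case: eqVneq => [/val_inj ->|_]; last by rewrite scale0r.
by rewrite (_ : U_(i) - U_(i) = 0)%MM ?mpolyX0 ?scale1r //; apply/mnmP => l; rewrite mnmBE subnn mnm0E.
Qed.

Lemma mderiv_even_mon (i : 'I_8) m :
  (even_mon m)^`M(i) = (count_mem (i : nat) m)%:R *: even_mon (rem (i : nat) m).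
Proof.
elim: m => [|j m IH] /=; first by rewrite /even_mon big_nil mderivC scale0r.
rewrite /even_mon big_cons -/(even_mon m) mderivM mderiv_even_var IH natrD scalerDl.
case: eqP => [->|_] /=; last first.
  by rewrite mul0r scale0r !add0r -scalerAr /even_mon big_cons.
rewrite mul1r scale1r -scalerAr; congr (_ + _).
case: (boolP (nat_of_ord i \in m)) => [im|/count_memPn ->]; last by rewrite !scale0r.
by congr (_ *: _); rewrite /even_mon (perm_big _ (perm_to_rem im)) big_cons.
Qed.

Lemma dx_odd_mon i s : dx i (odd_mon s) = 0.
Proof.
have dx_const f j : f^`M(i) = 0 -> dx i (vterm f j : mv) = 0.
  by move=> f0; apply/ffunP => A; rewrite !ffunE; case: ifP; rewrite ?mderiv0.
elim: s => [|k s IH] /=.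
  by rewrite dx_mvfun mderivC; apply/ffunP => A; rewrite !ffunE if_same.
rewrite dx_wedge IH wedge0r addr0 /odd_var; case: insubP => [j _ _|_].
  by rewrite dx_const ?mderivC // wedge0l.
by rewrite dx0 wedge0l.
Qed.

Lemma deriv_termE (i : 'I_8) t : ev (deriv_term i t) = dx i (ev_term t).
Proof.
case: t => c [m s]; rewrite /deriv_term /ev_term /= dxZ dx_wedge dx_odd_mon wedge0r addr0.
rewrite dx_mvfun mderiv_even_mon mvfunZ wedgeZl.
case: ifP => [_|/negbT/count_memPn ->]; last by rewrite ev_nil scale0r scaler0.
by rewrite ev1 /ev_term /= scalM scal_nat scalerA.
Qed.

Lemma ev_flatten I (r : seq I) (F : I -> terms) :
  ev (flatten [seq F k | k <- r]) = \sum_(k <- r) ev (F k).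
Proof. by elim: r => [|k r IH] /=; rewrite ?big_nil ?ev_nil // ev_cat IH big_cons. Qed.

Lemma deriv_termsE (i : 'I_8) p : ev (deriv_terms i p) = dx i (ev p).
Proof. by rewrite ev_flatten dx_sum; apply: eq_bigr => t _; apply: deriv_termE. Qed.

Lemma lder_odd_var i k : lder i (odd_var k) = mvfun (k == i :> nat)%:R :> mv.
Proof.
rewrite /odd_var; case: insubP => [j _ <-|kge].
  by rewrite vterm_vfield lder_vfield val_eqE eq_sym.
rewrite lder_0; case: eqP => [e|_]; first by rewrite e ltn_ord in kge.
by apply/ffunP => A; rewrite !ffunE if_same.
Qed.

Lemma lder_odd_mon (i : 'I_8) s :
  lder i (odd_mon s) = \sum_(r <- contract i s) scal r.1 *: odd_mon r.2.
Proof.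
elim: s => [|k s IH] /=; first by rewrite big_nil (lder0 i (@of_deg_mvfun _ _ _)).
rewrite (lder_wedge i _ (@of_deg_odd_var k)) lder_odd_var big_cat /= big_map IH.
congr (_ + _).
  case: eqP => _ /=; first by rewrite big_seq1 scal1 scale1r wedge1l.
  by rewrite big_nil; apply/ffunP => A; rewrite wedge_mvfun mul0r ffunE.
rewrite expr1 scaleN1r wedge_sumr -sumrN; apply: eq_bigr => r _ /=.
by rewrite wedgeZr scalN scaleNr.
Qed.

Lemma contract_termE (i : 'I_8) t : ev (contract_term i t) = lder i (ev_term t).
Proof.
case: t => c [m s]; rewrite /contract_term /ev_term lderZ (lder_wedge i _ (@of_deg_mvfun _ _ _)).
rewrite (lder0 i (@of_deg_mvfun _ _ _)) wedge0l add0r scale1r lder_odd_mon.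
rewrite /ev big_map wedge_sumr scaler_sumr; apply: eq_bigr => r _.
by rewrite /ev_term /= wedgeZr scalerA scalM.
Qed.

Lemma left_contractE (i : 'I_8) p : ev (left_contract i p) = lder i (ev p).
Proof. by rewrite ev_flatten lder_sum; apply: eq_bigr => t _; apply: contract_termE. Qed.

Lemma right_contractE (i : 'I_8) p : ev (right_contract i p) = rder i (ev p).
Proof.
rewrite ev_flatten rder_sum; apply: eq_bigr => t _.
rewrite ev_scale contract_termE (rder_lder i (@of_deg_ev_term t)) -signr_odd /=.
by case: (odd _); rewrite /= ?expr0 ?expr1.
Qed.

Lemma bracketE p q : ev (bracket p q) = schouten (ev p) (ev q).
Proof.
rewrite /bracket normal_formE ev_flatten big_mkord.
apply: eq_bigr => i _.
rewrite ev_cat ev_scale !ev_mul right_contractE left_contractE !deriv_termsE.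
by rewrite scaleN1r.
Qed.

Lemma ev_eq p q : normal_form (p ++ scale_terms (-1)%zz q) = [::] -> ev p = ev q.
Proof.
move=> H; apply/eqP; rewrite -subr_eq0 -scaleN1r.
by rewrite -[-1]/(scal (-1)%zz) -ev_scale -ev_cat -normal_formE H ev_nil.
Qed.
End Semantics.

(** * From polynomial expressions to lists of terms *)

Section Reification.
Variables (K : numFieldType) (par : seq K).
Implicit Types (f g : {mpoly K[8]}) (R Q : mvf K 8) (p q : terms).

Definition reified R p : Prop := R = ev par p.

Lemma reified_add R Q p q :
  reified R p -> reified Q q -> reified (R + Q) (p ++ q).
Proof. by move=> -> ->; rewrite /reified ev_cat. Qed.

Lemma reified_scale (a : K) R p q :
  reified (mvfun a%:MP) p -> reified R q -> reified (a *: R) (mul_terms p q).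
Proof.
move=> ep ->; rewrite /reified ev_mul -ep; apply/ffunP => A.
by rewrite wedge_mvfun ffunE mul_mpolyC.
Qed.

Lemma reified_vterm f i p :
  reified (mvfun f) p -> reified (vterm f i) (mul_terms p [:: (1%zz, ([::], [:: i : nat]))]).
Proof.
move=> ep; rewrite /reified vtermE ep ev_mul ev1 /ev_term /= scal1 scale1r.
by rewrite /even_mon big_nil wedge1l odd_varE -(wedge0C _ (@of_deg_mvfun _ _ 1)) wedge1l.
Qed.

Lemma reified_fun_add f g p q :
  reified (mvfun f) p -> reified (mvfun g) q -> reified (mvfun (f + g)) (p ++ q).
Proof. by move=> ep eq; rewrite /reified mvfunD ep eq ev_cat. Qed.

Lemma reified_fun_mul f g p q :
  reified (mvfun f) p -> reified (mvfun g) q -> reified (mvfun (f * g)) (mul_terms p q).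
Proof. by move=> ep eq; rewrite /reified mvfunM ep eq ev_mul. Qed.

Lemma reified_fun_sqr f p :
  reified (mvfun f) p -> reified (mvfun (f ^+ 2)) (mul_terms p p).
Proof. by move=> ep; rewrite /reified expr2 mvfunM ep ev_mul. Qed.

Lemma reified_fun_opp f p :
  reified (mvfun f) p -> reified (mvfun (- f)) (scale_terms (-1)%zz p).
Proof. by move=> ep; rewrite /reified -scaleN1r mvfunZ ep ev_scale. Qed.

Lemma reified_fun_scale (a : K) f p q :
  reified (mvfun a%:MP) p -> reified (mvfun f) q -> reified (mvfun (a *: f)) (mul_terms p q).
Proof. by move=> ep eq; rewrite -mul_mpolyC; apply: reified_fun_mul. Qed.

Lemma reified_mon (c : Z) m : reified (mvfun (scal K c *: even_mon par m)) [:: (c, (m, [::]))].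
Proof.
by rewrite /reified ev1 /ev_term /= mvfunZ (wedge0C _ (@of_deg_mvfun _ _ _)) wedge1l.
Qed.

Lemma reified_nat n : reified (mvfun n%:R) [:: (Z.of_nat n, ([::], [::]))].
Proof.
have := reified_mon (Z.of_nat n) [::].
by rewrite /even_mon big_nil scal_nat scaler_nat.
Qed.

Lemma reified_var i : reified (mvfun 'X_i) [:: (1%zz, ([:: i : nat], [::]))].
Proof.
have := reified_mon 1%zz [:: i : nat].
by rewrite /even_mon big_seq1 scal1 scale1r even_varE.
Qed.

Lemma reified_par i :
  reified (mvfun (par`_i)%:MP) [:: (1%zz, ([:: (8 + i)%N], [::]))].
Proof.
have := reified_mon 1%zz [:: (8 + i)%N].
rewrite /even_mon big_seq1 scal1 scale1r /even_var insubF; last by rewrite ltnNge leq_addr.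
have -> //: (8 + i - 8 = i)%N by rewrite addKn.
Qed.

Lemma reified_C_add (a b : K) p :
  reified (mvfun (a%:MP + b%:MP)) p -> reified (mvfun (a + b)%:MP) p.
Proof. by rewrite mpolyCD. Qed.

Lemma reified_C_opp (a : K) p :
  reified (mvfun (- a%:MP)) p -> reified (mvfun (- a)%:MP) p.
Proof. by rewrite mpolyCN. Qed.

Lemma reified_C_mul (a b : K) p :
  reified (mvfun (a%:MP * b%:MP)) p -> reified (mvfun (a * b)%:MP) p.
Proof. by rewrite mpolyCM. Qed.

Lemma reified_C_sqr (a : K) p :
  reified (mvfun (a%:MP ^+ 2)) p -> reified (mvfun (a ^+ 2)%:MP) p.
Proof. by rewrite rmorphXn. Qed.

Lemma reified_C_nat n p :
  reified (mvfun n%:R) p -> reified (mvfun n%:R%:MP) p.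
Proof. by rewrite rmorph_nat. Qed.
End Reification.

(* Dispatches on the syntax only: applying the lemmas by unification would
   unfold the polynomial operations. *)
Ltac reify :=
  lazymatch goal with
  | |- reified _ (mvfun (_ + _)) _ => apply: reified_fun_add; reify
  | |- reified _ (mvfun (_ * _)) _ => apply: reified_fun_mul; reify
  | |- reified _ (mvfun (_ ^+ 2)) _ => apply: reified_fun_sqr; reify
  | |- reified _ (mvfun (- _)) _ => apply: reified_fun_opp; reify
  | |- reified _ (mvfun (_ *: _)) _ => apply: reified_fun_scale; reify
  | |- reified _ (mvfun 'X_ _) _ => apply: reified_var
  | |- reified _ (mvfun (_ + _)%:MP) _ => apply: reified_C_add; reify
  | |- reified _ (mvfun (_ * _)%:MP) _ => apply: reified_C_mul; reify
  | |- reified _ (mvfun (_ ^+ 2)%:MP) _ => apply: reified_C_sqr; reify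
  | |- reified _ (mvfun (- _)%:MP) _ => apply: reified_C_opp; reify
  | |- reified _ (mvfun (_ %:R)%:MP) _ => apply: reified_C_nat; reify
  | |- reified _ (mvfun _%:MP) _ => apply: reified_par
  | |- reified _ (mvfun _%:R) _ => apply: reified_nat
  | |- reified _ (_ + _) _ => apply: reified_add; reify
  | |- reified _ (_ *: _) _ => apply: reified_scale; reify
  | |- reified _ (vterm _ _) _ => apply: reified_vterm; reify
  end.

(** * The data of the theorem as lists of terms *)

(** The list is found by reification and does not depend on [K] or [b], as [b]
    enters through the parameter variables; hence the transparent proof. *)
Lemma X_reified :
  {p : terms | forall (K : numFieldType) (b : 10.-tuple K), reified b (Xb b) p}.
Proof.
eexists=> K b; rewrite /Xb !big_ord_recl big_ord0 addr0 /=.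
rewrite /X0 /X1 /X2 /X3 /X4 /X5 /X6 /X7 /X8 /X9; reify.
Defined.

Lemma Q_reified :
  {p : terms | forall (K : numFieldType) (b : 10.-tuple K), reified b (mvfun (Qb b)) p}.
Proof. by eexists=> K b; rewrite /Qb /Qform /=; reify. Defined.

Definition Xb_terms : terms := Eval vm_compute in normal_form (sval X_reified).
Definition Qb_terms : terms := Eval vm_compute in normal_form (sval Q_reified).

Lemma Xb_termsE (K : numFieldType) (b : 10.-tuple K) : Xb b = ev b Xb_terms.
Proof. by rewrite (svalP X_reified) -normal_formE. Qed.

Lemma Qb_termsE (K : numFieldType) (b : 10.-tuple K) : mvfun (Qb b) = ev b Qb_terms.
Proof. by rewrite (svalP Q_reified) -normal_formE. Qed.

(** As [X_b] is linear in [b] and [Q_b] quadratic, [X_i] and [q_ij] are their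
    derivatives with respect to the parameters. *)
Definition X_terms i : terms := deriv_terms (8 + i) Xb_terms.
Definition q_terms i j : terms := deriv_terms (8 + i) (deriv_terms (8 + j) Qb_terms).

(** Integral matrices, indexed by natural numbers so that they evaluate. *)
Definition zmatrix : Type := nat -> nat -> Z.

Definition zunit a c : zmatrix := fun i j => if (i == a) && (j == c) then 1%zz else 0%zz.

Definition zbasis (i : nat) : zmatrix :=
  nth ((fun _ _ => 0%zz) : zmatrix)
    [:: zunit 0 1; zunit 0 2; zunit 1 0; zunit 1 2; zunit 2 0; zunit 2 1;
        fun a c => Z.sub (zunit 0 0 a c) (zunit 2 2 a c);
        fun a c => Z.sub (zunit 1 1 a c) (zunit 2 2 a c)] i.

Definition zcomm (A B : zmatrix) : zmatrix := fun a c =>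
  foldr (fun k s => (A a k * B k c - B a k * A k c + s)%zz) 0%zz (iota 0 3).

Definition lin_terms (A : zmatrix) : terms :=
  [:: (A 0 1, ([:: 0], [::])); (A 0 2, ([:: 1], [::])); (A 1 0, ([:: 2], [::]));
      (A 1 2, ([:: 3], [::])); (A 2 0, ([:: 4], [::])); (A 2 1, ([:: 5], [::]));
      (A 0 0, ([:: 6], [::])); (A 1 1, ([:: 7], [::]))]%N.

Definition poisson_terms : terms :=
  flatten [seq flatten [seq
      mul_terms (mul_terms (lin_terms (zcomm (zbasis i) (zbasis j))) [:: (1%zz, ([::], [:: i]))])
          [:: (1%zz, ([::], [:: j]))]
    | j <- index_iota 0 8 & (i < j)%N] | i <- index_iota 0 8].

Definition P_terms : terms := Eval vm_compute in normal_form poisson_terms.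

Section Poisson.
Variables (K : numFieldType) (par : seq K).

Definition entries (M : 'M[K]_3) (A : zmatrix) := forall a c, M a c = scal K (A a c).

Lemma sl3_lin_reified M A :
  entries M A -> reified par (mvfun (sl3_lin M)) (lin_terms A).
Proof.
move=> eM.
have E c (k : 'I_8) : reified par (mvfun (scal K c *: 'X_k)) [:: (c, ([:: k : nat], [::]))].
  by rewrite -(even_varE par) /reified -reified_mon /even_mon big_seq1.
rewrite /sl3_lin !eM.
have D f g p t : reified par (mvfun f) p -> reified par (mvfun g) [:: t] ->
    reified par (mvfun (f + g)) (p ++ [:: t]) by apply: reified_fun_add.
exact: (D _ _ _ _ (D _ _ _ _ (D _ _ _ _ (D _ _ _ _ (D _ _ _ _ (D _ _ _ _
  (D _ _ _ _ (E _ _) (E _ _)) (E _ _)) (E _ _)) (E _ _)) (E _ _)) (E _ _)) (E _ _)).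
Qed.

Lemma unit_entries (a c : 'I_3) : entries (delta_mx a c) (zunit a c).
Proof. by move=> i j; rewrite mxE /zunit !val_eqE; case: ifP. Qed.

Lemma sub_entries M N A B : entries M A -> entries N B ->
  entries (M - N) (fun a c => Z.sub (A a c) (B a c)).
Proof. by move=> eM eN a c; rewrite !mxE eM eN -scalN -scalD. Qed.

Lemma sl3_basis_entries (i : 'I_8) : entries (sl3_basis K i) (zbasis i).
Proof.
case: i => [[|[|[|[|[|[|[|[|//]]]]]]]] hi].
1-6: exact: unit_entries.
1-2: by apply: sub_entries; apply: unit_entries.
Qed.

Lemma comm_entries M N A B : entries M A -> entries N B ->
  entries (M *m N - N *m M) (zcomm A B).
Proof.
move=> eM eN a c; rewrite !mxE !big_ord_recl !big_ord0 /zcomm /= !eM !eN.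
rewrite !(scalD, scalM, scalN, scal0).
ring.
Qed.

Lemma odd_reified (i : 'I_8) : reified par (vterm 1 i) [:: (1%zz, ([::], [:: i : nat]))].
Proof.
rewrite /reified ev1 /ev_term /= scal1 scale1r /even_mon big_nil wedge1l odd_varE.
by rewrite -(wedge0C _ (@of_deg_mvfun _ _ 1)) wedge1l.
Qed.

Lemma P_termsE : lie_poisson K = ev par P_terms.
Proof.
have -> : P_terms = normal_form poisson_terms by vm_compute.
rewrite normal_formE ev_flatten [RHS]big_mkord; apply: eq_bigr => i _.
rewrite ev_flatten [RHS]big_filter [RHS]big_mkord; apply: eq_bigr => j _.
rewrite ev_mul; congr wedge; last exact: odd_reified.
rewrite vtermE ev_mul; congr wedge; last exact: odd_reified.
by apply: sl3_lin_reified; apply: comm_entries; apply: sl3_basis_entries.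
Qed.

(** [(a, c)] stands for the matrix unit [E_(a+1)(c+1)].  The first two root
    vectors annihilate [X_8] and move [X_7]; the last two move [X_8]. *)
Definition roots : seq (nat * nat) := [:: (1, 0); (1, 2); (2, 0); (2, 1)]%N.

Definition root_mx g : 'M[K]_3 :=
  \matrix_(i, j) scal K (zunit (nth (0, 0) roots g).1 (nth (0, 0) roots g).2 i j)%N.
End Poisson.

(** * The action of the root vectors *)

Definition ham_terms g : terms :=
  bracket P_terms (lin_terms (zunit (nth (0, 0) roots g).1 (nth (0, 0) roots g).2))%N.

Definition terms_agree p q : bool := nilp (normal_form (p ++ scale_terms (-1)%zz q)).

(** The root vector number [g] maps [X_i] to [coef g i] times [X_(target g i)];
    a coefficient 0 comes with the default target 0. *)
Definition coef g i : Z := nth 0%zz (nth [::]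
  [:: [:: -2; -1;  1;  0;  0; -1;  2; -3;  0;  0];
      [:: -2;  2; -1;  0;  0;  1; -1; -3;  0;  0];
      [:: -2;  1; -1; -1;  2;  0;  0;  0; -3;  0];
      [:: -2; -1;  2;  1; -1;  0;  0;  0; -3;  0]]%zz g) i.

Definition target g i : nat := nth 0%N (nth [::]
  [:: [:: 3; 0; 4; 0; 0; 9; 5; 6; 0; 0];
      [:: 4; 2; 8; 0; 0; 3; 0; 1; 0; 0];
      [:: 5; 6; 0; 9; 3; 0; 0; 0; 4; 0];
      [:: 6; 7; 1; 5; 0; 0; 0; 0; 2; 0]] g)%N i.

Lemma ham_P_agree : all (fun g => terms_agree (bracket (ham_terms g) P_terms) [::]) (iota 0 4).
Proof. by vm_compute. Qed.

Lemma ham_X_agree : all (fun g => all (fun i =>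
  terms_agree (bracket (ham_terms g) (X_terms i))
    (scale_terms (coef g i) (X_terms (target g i)))) (iota 0 10)) (iota 0 4).
Proof. by vm_compute. Qed.

Lemma ham_q_agree : all (fun g => all (fun i => all (fun j =>
  terms_agree (bracket (ham_terms g) (q_terms i j))
    (scale_terms (coef g i) (q_terms (target g i) j)
       ++ scale_terms (coef g j) (q_terms i (target g j))))
  (iota 0 10)) (iota 0 10)) (iota 0 4).
Proof. by vm_compute. Qed.

(** The only trivector computed explicitly, on two vector fields with few
    terms. *)
Lemma extreme_pair_agree : terms_agree
  (bracket (bracket (X_terms 8) P_terms) (bracket (X_terms 7) P_terms))
  (mul_terms (bracket P_terms (q_terms 8 7)) P_terms).
Proof. by vm_compute. Qed.

(** Up to a scalar, [q_87] is [x_12 x_13 = {x_13^2, x_32} / 2]. *)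
Lemma q_extreme_agree : terms_agree (q_terms 8 7)
  (scale_terms (Z.of_nat 162) (bracket (ham_terms 3) [:: (1%zz, ([:: 1; 1]%N, [::]))])).
Proof. by vm_compute. Qed.

Definition par_term i : terms := [:: (1%zz, ([:: (8 + i)%N], [::]))].

Lemma Xb_expansion_agree : terms_agree Xb_terms
  (flatten [seq mul_terms (par_term i) (X_terms i) | i <- index_iota 0 10]).
Proof. by vm_compute. Qed.

(** Euler's relation: the second derivatives count every product [b_i b_j] twice,
    whence the factor 2. *)
Lemma Qb_expansion_agree : terms_agree (scale_terms (Z.of_nat 2) Qb_terms)
  (flatten [seq flatten [seq mul_terms (par_term i) (mul_terms (par_term j) (q_terms i j))
    | j <- index_iota 0 10] | i <- index_iota 0 10]).
Proof. by vm_compute. Qed.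

(** * Generation by a pair of extreme weight vectors *)

Lemma target_lt g j : (g < 4)%N -> (j < 10)%N -> (target g j < 10)%N.
Proof.
by case: g => [|[|[|[|//]]]] _; case: j => [|[|[|[|[|[|[|[|[|[|//]]]]]]]]]].
Qed.

Section Generation.
Variables (K : numFieldType) (V : lmodType K) (N : V -> Prop).
Variables (L : nat -> V -> V) (F : nat -> nat -> V).
Hypothesis N_linear : forall (a : K) u v, N u -> N v -> N (a *: u + v).
Hypothesis N_stable : forall g u, (g < 4)%N -> N u -> N (L g u).
Hypothesis F_equivariant : forall g i j, (g < 4)%N -> (i < 10)%N -> (j < 10)%N ->
  L g (F i j) = scal K (coef g i) *: F (target g i) j + scal K (coef g j) *: F i (target g j).

Lemma N_scale_inv (a : K) u : N 0 -> a != 0 -> N (a *: u) -> N u.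
Proof.
move=> N0 a0 /(N_linear a^-1)/(_ N0).
by rewrite scalerA mulVf // scale1r addr0.
Qed.

Lemma N_sub u v : N u -> N (v + u) -> N v.
Proof. by move=> Nu /(N_linear (-1) Nu); rewrite scaleN1r addrCA addNr addr0. Qed.

Lemma move_right g i j : (g < 4)%N -> (i < 10)%N -> (j < 10)%N ->
  coef g i = 0%zz -> scal K (coef g j) != 0 ->
  N 0 -> N (F i j) -> N (F i (target g j)).
Proof.
move=> lg li lj ci cj N0 /(N_stable lg); rewrite F_equivariant // ci scal0 scale0r add0r.
exact: N_scale_inv.
Qed.

Lemma move_left g i : (g < 4)%N -> (i < 10)%N -> scal K (coef g i) != 0 -> N 0 ->
  (forall j, (j < 10)%N -> N (F i j)) ->
  forall j, (j < 10)%N -> N (F (target g i) j).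
Proof.
move=> lg li ci N0 Fi j lj; apply: (N_scale_inv N0 ci).
have := N_stable lg (Fi j lj); rewrite F_equivariant //; apply: N_sub.
rewrite -[_ *: _]addr0; apply: N_linear => //; apply: Fi.
exact: target_lt.
Qed.

(** The submodule [N] contains [F 8 7].  Two root vectors annihilate the first
    argument [8], so they move the second one freely, and they lead from [7] to
    every index.  The other two lead from [8] to every index; applied to [F i j],
    they also produce a term [F i j'], which is known to lie in [N] as soon as
    all the [F i j] do. *)
Lemma extreme_pair_generates : N (F 8 7) -> forall i j, (i < 10)%N -> (j < 10)%N -> N (F i j).
Proof.
move=> N87.
have N0 : N 0 by rewrite -[0](addNr (F 8 7)) -scaleN1r; apply: N_linear.
(* [K] has characteristic 0. *)
have nz c : c != 0%zz -> scal K c != 0.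
  by rewrite /scal intr_eq0; apply: contra => /eqP c0; rewrite -(int_of_ZK c) c0.
have R g j lg lj c8 (c : coef g j != 0%zz) :=
  @move_right g 8 j lg isT lj c8 (nz _ c) N0.
have N8 j : (j < 10)%N -> N (F 8 j).
  have N86 : N (F 8 6) by apply: (R 0 7)%N.
  have N85 : N (F 8 5) by apply: (R 0 6)%N.
  have N89 : N (F 8 9) by apply: (R 0 5)%N.
  have N81 : N (F 8 1) by apply: (R 1 7)%N.
  have N82 : N (F 8 2) by apply: (R 1 1)%N.
  have N88 : N (F 8 8) by apply: (R 1 2)%N.
  have N80 : N (F 8 0) by apply: (R 0 1)%N.
  have N83 : N (F 8 3) by apply: (R 0 0)%N.
  have N84 : N (F 8 4) by apply: (R 0 2)%N.
  by do 10?[case: j => [|j] //].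
have S g i (lg : (g < 4)%N) (li : (i < 10)%N) (c : coef g i != 0%zz) :=
  move_left lg li (nz _ c) N0.
have N4 := S 2 8 isT isT isT N8.
have N3 := S 2 4 isT isT isT N4.
have N9 := S 2 3 isT isT isT N3.
have N2 := S 3 8 isT isT isT N8.
have N1 := S 3 2 isT isT isT N2.
have N7 := S 3 1 isT isT isT N1.
have N_0 := S 2 2 isT isT isT N2.
have N5 := S 2 0 isT isT isT N_0.
have N6 := S 2 1 isT isT isT N1.
by case=> [|[|[|[|[|[|[|[|[|[|//]]]]]]]]]] j _ lj; auto.
Qed.
End Generation.

Lemma all_iota n (a : pred nat) : all a (iota 0 n) -> forall i, (i < n)%N -> a i.
Proof. by move=> /allP H i li; apply: H; rewrite mem_iota. Qed.

(** * The identity *)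

Section Identity.
Variables (K : numFieldType) (b : 10.-tuple K).

Local Notation P := (lie_poisson K).

(** The parameters do not occur in [X_terms i] and [q_terms i j], so these are the
    vector field [X_i] and the form [q_ij], for any [b]. *)
Definition Xvec i : mvf K 8 := ev b (X_terms i).
Definition q i j : mvf K 8 := ev b (q_terms i j).
Definition root_field g : mvf K 8 := ham (sl3_lin (root_mx K g)).
Definition lie g (R : mvf K 8) := schouten (root_field g) R.
Definition defect i j : mvf K 8 := bracket_defect P (Xvec i) (Xvec j) (q i j).

Lemma terms_agreeE p p' : terms_agree p p' -> ev b p = ev b p'.
Proof. by move/nilP; apply: ev_eq. Qed.

Lemma PE : P = ev b P_terms. Proof. exact: P_termsE. Qed.

Lemma root_fieldE g : root_field g = ev b (ham_terms g).
Proof.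
rewrite /root_field /ham (P_termsE b) bracketE; congr schouten.
by apply: sl3_lin_reified => i j; rewrite mxE.
Qed.

Lemma lieE g p : lie g (ev b p) = ev b (bracket (ham_terms g) p).
Proof. by rewrite /lie root_fieldE bracketE. Qed.

Lemma lie_P g : (g < 4)%N -> lie g P = 0.
Proof.
move=> lg; rewrite PE lieE -(ev_nil b); apply: terms_agreeE.
exact: (all_iota ham_P_agree).
Qed.

Lemma lie_Xvec g i : (g < 4)%N -> (i < 10)%N ->
  lie g (Xvec i) = scal K (coef g i) *: Xvec (target g i).
Proof.
move=> lg li; rewrite lieE -ev_scale; apply: terms_agreeE.
exact: (all_iota (all_iota ham_X_agree lg)).
Qed.

Lemma lie_q g i j : (g < 4)%N -> (i < 10)%N -> (j < 10)%N ->
  lie g (q i j) =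
  scal K (coef g i) *: q (target g i) j + scal K (coef g j) *: q i (target g j).
Proof.
move=> lg li lj; rewrite lieE -!ev_scale -ev_cat; apply: terms_agreeE.
exact: (all_iota (all_iota (all_iota ham_q_agree lg) li)).
Qed.

Lemma of_deg_Xvec i : (i < 10)%N -> of_deg 1 (Xvec i).
Proof.
move=> li; apply: of_deg_ev.
by do 10?[case: i li => [|i] li; first by vm_compute].
Qed.

Lemma of_deg_q i j : (i < 10)%N -> (j < 10)%N -> of_deg 0 (q i j).
Proof.
have H : all (fun i => all (fun j => has_deg 0 (q_terms i j)) (iota 0 10)) (iota 0 10).
  by vm_compute.
move=> li lj; apply: of_deg_ev; exact: (all_iota (all_iota H li)).
Qed.

Lemma of_deg_P : of_deg 2 P.
Proof. by rewrite PE; apply: of_deg_ev; vm_compute. Qed.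

Lemma of_deg_root_field g : (g < 4)%N -> of_deg 1 (root_field g).
Proof.
by move=> lg; apply: of_deg_schouten_fun; [apply: of_deg_P | apply: of_deg_mvfun].
Qed.

Lemma lie_defect g i j : (g < 4)%N -> (i < 10)%N -> (j < 10)%N ->
  lie g (defect i j) =
  scal K (coef g i) *: defect (target g i) j + scal K (coef g j) *: defect i (target g j).
Proof.
move=> lg li lj; apply: vf_defect (of_deg_root_field lg) of_deg_P _ _ _ (lie_P lg) _ _ _.
- exact: of_deg_Xvec.
- exact: of_deg_Xvec.
- exact: of_deg_q.
- exact: lie_Xvec.
- exact: lie_Xvec.
- exact: lie_q.
Qed.

Lemma defect0 i j : (i < 10)%N -> (j < 10)%N -> defect i j = 0.
Proof.
apply: (extreme_pair_generates (L := lie) (N := fun R => R = 0)) => [a u v -> ->|g u _ ->||].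
- by rewrite scaler0 addr0.
- exact: schouten0r.
- exact: lie_defect.
apply/eqP; rewrite subr_eq0 /Xvec /q PE; apply/eqP.
rewrite -!bracketE -ev_mul; apply: terms_agreeE; exact: extreme_pair_agree.
Qed.

(** [U27] for multivectors, so that [extreme_pair_generates] applies. *)
Definition in_U27 (R : mvf K 8) : Prop :=
  forall S, sl3_submodule S -> S (mvfun ('X_c13 ^+ 2)) -> S R.

Lemma root_mx_tr g : (g < 4)%N -> \tr (root_mx K g) = 0.
Proof.
rewrite /mxtrace !big_ord_recl big_ord0 !mxE.
by case: g => [|[|[|[|//]]]] _; rewrite !addr0.
Qed.

Lemma q_U27 i j : (i < 10)%N -> (j < 10)%N -> in_U27 (q i j).
Proof.
apply: (extreme_pair_generates (L := lie) (N := in_U27)) => [a u v Uu Uv|g u lg Uu||].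
- by move=> S HS S0; case: (HS) => _ Slin _; apply: Slin; [apply: Uu | apply: Uv].
- move=> S HS S0; case: (HS) => _ _ Sstable; apply: Sstable; last exact: Uu.
  exact: root_mx_tr.
- exact: lie_q.
move=> S HS S0; case: (HS) => Sz Slin Sstable.
rewrite /q (terms_agreeE q_extreme_agree) ev_scale -lieE -[_ *: _]addr0; apply: Slin => //.
apply: Sstable; first exact: root_mx_tr.
have <- : mvfun ('X_c13 ^+ 2) = ev b [:: (1%zz, ([:: 1; 1]%N, [::]))]; last exact: S0.
rewrite -reified_mon /even_mon big_cons big_seq1 scal1 scale1r.
by rewrite (even_varE b c13) expr2.
Qed.

Lemma Xb_sum : Xb b = \sum_(i < 10) b`_i *: Xvec i.
Proof.
rewrite Xb_termsE (terms_agreeE Xb_expansion_agree) ev_flatten big_mkord.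
apply: eq_bigr => i _; symmetry; apply: reified_scale; last by [].
exact: reified_par.
Qed.

Lemma Qb_sum : 2 *: mvfun (Qb b) = \sum_(i < 10) \sum_(j < 10) (b`_i * b`_j) *: q i j.
Proof.
rewrite Qb_termsE -[2]/(2%:R) -scal_nat -ev_scale (terms_agreeE Qb_expansion_agree).
rewrite ev_flatten big_mkord.
apply: eq_bigr => i _; rewrite ev_flatten big_mkord; apply: eq_bigr => j _.
symmetry; rewrite -scalerA.
apply: reified_scale; first exact: reified_par.
by apply: reified_scale; first exact: reified_par.
Qed.

Lemma Qb_homog : Qb b \is 2.-homog.
Proof.
have h1 (i : 'I_8) : ('X_i : {mpoly K[8]}) \is 1.-homog.
  by rewrite dhomogX; apply/eqP; exact: mdeg1.
have hX (i j : 'I_8) : ('X_i * 'X_j : {mpoly K[8]}) \is 2.-homog.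
  exact: (dhomogM (h1 i) (h1 j)).
have hX2 (i : 'I_8) : ('X_i ^+ 2 : {mpoly K[8]}) \is 2.-homog by rewrite expr2.
by apply: rpredZ; do ![apply: rpredD]; apply: rpredZ.
Qed.

Lemma Qb_U27 : U27 (Qb b).
Proof.
move=> S HS S0; case: (HS) => Sz Slin Sstable.
have SZ a R : S R -> S (a *: R) by move=> SR; rewrite -[_ *: _]addr0; apply: Slin.
have Ssum (F : 'I_10 -> mvf K 8) : (forall i, S (F i)) -> S (\sum_(i < 10) F i).
  move=> SF; elim/big_ind: _ => // u v Su Sv.
  by rewrite -[u]scale1r; apply: Slin.
have two0 : (2 : K) != 0 by rewrite pnatr_eq0.
rewrite -[mvfun _]scale1r -(mulVf two0) -scalerA Qb_sum.
by apply: (SZ); apply: (Ssum) => i; apply: (Ssum) => j; apply: (SZ); apply: q_U27.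
Qed.

Lemma Xb_identity :
  schouten (schouten (Xb b) P) (schouten (Xb b) P) = 2 *: wedge (schouten P (mvfun (Qb b))) P.
Proof.
transitivity (\sum_(i < 10) \sum_(j < 10)
    (b`_i * b`_j) *: schouten (schouten (Xvec i) P) (schouten (Xvec j) P)).
  have -> : schouten (Xb b) P = \sum_(i < 10) b`_i *: schouten (Xvec i) P.
    by rewrite Xb_sum schouten_suml; apply: eq_bigr => i _; rewrite schoutenZl.
  rewrite schouten_suml; apply: eq_bigr => i _.
  rewrite schoutenZl schouten_sumr scaler_sumr; apply: eq_bigr => j _.
  by rewrite schoutenZr scalerA.
rewrite -wedgeZl -schoutenZr Qb_sum.
have -> : schouten P (\sum_(i < 10) \sum_(j < 10) (b`_i * b`_j) *: q i j) =
    \sum_(i < 10) \sum_(j < 10) (b`_i * b`_j) *: schouten P (q i j).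
  rewrite schouten_sumr; apply: eq_bigr => i _.
  by rewrite schouten_sumr; apply: eq_bigr => j _; rewrite schoutenZr.
rewrite wedge_suml; apply: eq_bigr => i _; rewrite wedge_suml; apply: eq_bigr => j _.
rewrite wedgeZl; congr (_ *: _).
by apply/eqP; rewrite -subr_eq0; apply/eqP; apply: defect0.
Qed.
End Identity.

Theorem theorem6p1 (R : realType) (k : base_field) (b : 10.-tuple (scalars R k)) :
  exists Q : {mpoly (scalars R k)[8]},
    [/\ Q \is 2.-homog,
        U27 Q,
        schouten (schouten (Xb b) (lie_poisson _)) (schouten (Xb b) (lie_poisson _))
          = 2 *: wedge (schouten (lie_poisson _) (mvfun Q)) (lie_poisson _)
      & Q = Qb b].
Proof.
by exists (Qb b); split; [apply: Qb_homog | apply: Qb_U27 | apply: Xb_identity |].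
Qed.
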